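(* Let $R$ be a commutative ring and let $t,n$ be integers with $4\le 2t\le n$. Let $M_R=\mathrm{Hom}_R(R^n,R^{2t-2})$, with the action of the symplectic group scheme $G_R=\mathrm{Sp}_{2t-2,R}$ given by $g\cdot\varphi=g\circ\varphi$, let $(Y_t)_R$ be the $R$-scheme of alternating $n\times n$ matrices all of whose main $2t\times 2t$ submatrices have vanishing Pfaffian, and consider the morphism $\pi\colon M_R\to(Y_t)_R$ over $R$ given on representation matrices by $X\mapsto {}^tX\tilde JX$. Then the associated ring homomorphism $R[(Y_t)_R]\to R[M_R]^{G_R}$ is an isomorphism.
   Context: A matrix $A=(a_{ij})$ over a commutative ring is alternating if $a_{ji}=-a_{ij}$ and $a_{ii}=0$. The Pfaffian of an alternating $2t\times 2t$ matrix is $\mathrm{Pfaff}(A)=\sum_{\sigma\in\Gamma}(-1)^\sigma a_{\sigma1\,\sigma2}a_{\sigma3\,\sigma4}\cdots a_{\sigma(2t-1)\,\sigma(2t)}$, where $(-1)^\sigma$ is the sign and $\Gamma$ is the set of permutations $\sigma\in\mathfrak S_{2t}$ with $\sigma1<\sigma3<\cdots<\sigma(2t-1)$ and $\sigma(2i-1)<\sigma(2i)$ for $1\le i\le t$. A main $2t\times2t$ submatrix of an alternating $n\times n$ matrix $(a_{ij})$ is a matrix $(a_{i_ui_v})_{1\le u,v\le 2t}$ with $1\le i_1<\cdots<i_{2t}\le n$. Coordinate ring of $(Y_t)_R$: $R[(Y_t)_R]=R[z_{ij}\mid 1\le i<j\le n]/\mathrm{Pf}_{2t}$, where $\mathrm{Pf}_{2t}$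 is the ideal generated by the Pfaffians of all main $2t\times 2t$ submatrices of the generic alternating matrix $(z_{ij})$ (with $z_{ji}=-z_{ij}$, $z_{ii}=0$). $J$ is the $(t-1)\times(t-1)$ matrix with $1$'s on the antidiagonal and $0$ elsewhere, and $\tilde J=\begin{pmatrix}O&J\\-J&O\end{pmatrix}$, of size $(2t-2)\times(2t-2)$. The group scheme $G_R$ represents the functor $A\mapsto\{g\in\mathrm{Mat}_{2t-2}(A)\mid {}^tg\tilde Jg=\tilde J\}$ on commutative $R$-algebras. $R[M_R]$ is the polynomial ring in the entries of a generic $(2t-2)\times n$ matrix $X$, and the ring homomorphism associated with $\pi$ sends $z_{ij}$ to the $(i,j)$ entry of ${}^tX\tilde JX$. $R[M_R]^{G_R}$ is the ring of scheme-theoretic invariants, i.e. those $f\in R[M_R]$ whose pullbacks under the action morphism and under the second projection $G_R\times_RM_R\to M_R$ coincide. *)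

(* Defs.v *)
From HB Require Import structures.
From mathcomp Require Import all_boot all_order perm all_algebra.
From mathcomp Require Import boolp mpoly.

Set Implicit Arguments.
Unset Strict Implicit.
Unset Printing Implicit Defensive.

Import GRing.Theory.
Local Open Scope ring_scope.
Local Open Scope quotient_scope.

(* The library's {ideal_quot I} asks for a proper decidable ideal.  Here the
   ideal is any finitely generated one (membership is decided classically), so
   the quotient is a comPzRingType: it is allowed to be the zero ring. *)
Section FinGenQuotient.
Variables (A : comPzRingType) (I : finType) (g : I -> A).

Definition gen_ideal : {pred A} :=
  fun a => `[< exists c : I -> A, a = \sum_i c i * g i >].

Lemma gen_idealP a :
  reflect (exists c : I -> A, a = \sum_i c i * g i) (a \in gen_ideal).
Proof. exact: asboolP. Qed.

Fact gen_ideal_zmod_closed : zmod_closed gen_ideal.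
Proof.
split=> [|_ _ /gen_idealP[c ->] /gen_idealP[d ->]]; apply/gen_idealP.
  by exists (fun=> 0); rewrite big1 // => i _; rewrite mul0r.
exists (fun i => c i - d i); rewrite -sumrB.
by apply: eq_bigr => i _; rewrite mulrBl.
Qed.

HB.instance Definition _ := GRing.isZmodClosed.Build A gen_ideal
  gen_ideal_zmod_closed.

Lemma gen_idealMr a u : u \in gen_ideal -> a * u \in gen_ideal.
Proof.
move=> /gen_idealP[c ->]; apply/gen_idealP; exists (fun i => a * c i).
by rewrite mulr_sumr; apply: eq_bigr => i _; rewrite mulrA.
Qed.

Definition quot_gen : Type := Quotient.quot gen_ideal.

HB.instance Definition _ := GRing.Zmodule.on quot_gen.
HB.instance Definition _ : EqQuotient A (Quotient.equiv gen_ideal) quot_gen :=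
  EqQuotient.on quot_gen.

Definition quot_gen_mul := lift_op2 quot_gen *%R.

Fact quot_gen_pi_mul : {morph \pi_quot_gen : x y / x * y >-> quot_gen_mul x y}.
Proof.
move=> x y; unlock quot_gen_mul; apply/eqP; rewrite piE Quotient.equivE.
set x' := repr _; set y' := repr _.
have hx : x - x' \in gen_ideal.
  by rewrite -Quotient.equivE -(@eqquotE _ _ quot_gen) reprK.
have hy : y - y' \in gen_ideal.
  by rewrite -Quotient.equivE -(@eqquotE _ _ quot_gen) reprK.
have -> : x * y - x' * y' = y * (x - x') + x' * (y - y').
  by rewrite !mulrBr mulrC [y * x']mulrC addrA subrK.
by rewrite rpredD // gen_idealMr.
Qed.

Fact quot_gen_mulA : associative quot_gen_mul.
Proof.
move=> x y z; rewrite -[x]reprK -[y]reprK -[z]reprK.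
by rewrite -!quot_gen_pi_mul mulrA.
Qed.

Fact quot_gen_mulC : commutative quot_gen_mul.
Proof.
by move=> x y; rewrite -[x]reprK -[y]reprK -!quot_gen_pi_mul mulrC.
Qed.

Fact quot_gen_mul1 : left_id (\pi_quot_gen 1) quot_gen_mul.
Proof. by move=> x; rewrite -[x]reprK -quot_gen_pi_mul mul1r. Qed.

Fact quot_gen_mulDl : left_distributive quot_gen_mul +%R.
Proof.
have pD : {morph \pi_quot_gen : x y / x + y >-> x + y}.
  by move=> x y; exact: (@pi_addr _ _ _ _ _ (Quotient.quot gen_ideal)).
move=> x y z; rewrite -[x]reprK -[y]reprK -[z]reprK -pD.
by rewrite -!quot_gen_pi_mul -pD mulrDl.
Qed.

HB.instance Definition _ := GRing.Zmodule_isComPzRing.Build quot_gen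
  quot_gen_mulA quot_gen_mulC quot_gen_mul1 quot_gen_mulDl.

Definition quot_class (a : A) : quot_gen := \pi_quot_gen a.

Fact quot_class_zmod_morphism : zmod_morphism quot_class.
Proof.
exact: (@pi_is_zmod_morphism _ _ _ (Quotient.quot gen_ideal)).
Qed.

Fact quot_class_monoid_morphism : monoid_morphism quot_class.
Proof. by split=> //; exact: quot_gen_pi_mul. Qed.

HB.instance Definition _ := GRing.isZmodMorphism.Build A quot_gen quot_class
  quot_class_zmod_morphism.
HB.instance Definition _ := GRing.isMonoidMorphism.Build A quot_gen quot_class
  quot_class_monoid_morphism.

Lemma quot_class_eq a b :
  (quot_class a == quot_class b) = (a - b \in gen_ideal).
Proof. by rewrite eqquotE Quotient.equivE. Qed.

End FinGenQuotient.

Section Pfaffian.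
Variables (A : comPzRingType) (t : nat).

(* The usual positions 2i - 1 and 2i (1 <= i <= t) become, counting from 0, the
   values 2i and 2i + 1 of pair_fst i and pair_snd i for i : 'I_t. *)
Definition pair_fst (i : 'I_t) : 'I_t.*2 :=
  Ordinal (etrans (ltn_double i t) (ltn_ord i)).
Definition pair_snd (i : 'I_t) : 'I_t.*2 :=
  Ordinal (etrans (ltn_Sdouble i t) (ltn_ord i)).

Definition pfaffian_perm (s : 'S_t.*2) : bool :=
  [forall i : 'I_t, forall j : 'I_t, (i < j)%N ==>
     (s (pair_fst i) < s (pair_fst j))%N] &&
  [forall i : 'I_t, (s (pair_fst i) < s (pair_snd i))%N].

Definition Pfaff (B : 'M[A]_t.*2) : A :=
  \sum_(s | pfaffian_perm s)
    (-1) ^+ s * \prod_(i < t) B (s (pair_fst i)) (s (pair_snd i)).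

End Pfaffian.

Section CoordinateRingY.
Variables (R : comNzRingType) (t n : nat).

Definition upper_pair := {p : 'I_n * 'I_n | (p.1 < p.2)%N}.

Definition polyZ := {mpoly R[#|{: upper_pair}|]}.
HB.instance Definition _ := GRing.ComNzRing.on polyZ.

Definition genericZ : 'M[polyZ]_n := \matrix_(i, j)
  if insub (i, j) is Some p then 'X_(enum_rank (p : upper_pair))
  else if insub (j, i) is Some p then - 'X_(enum_rank (p : upper_pair))
  else 0.

Definition main_index :=
  {u : {ffun 'I_t.*2 -> 'I_n} |
     [forall a : 'I_t.*2, forall b : 'I_t.*2, (a < b)%N ==> (u a < u b)%N]}.

Definition main_pfaffian (u : main_index) : polyZ :=
  Pfaff (mxsub (val u) (val u) genericZ).

Definition coordY := quot_gen main_pfaffian.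
HB.instance Definition _ := GRing.ComPzRing.on coordY.

End CoordinateRingY.

Definition antidiag (A : pzRingType) (k : nat) : 'M[A]_k :=
  \matrix_(i, j) (j == rev_ord i)%:R.

Definition Jtilde (A : pzRingType) (k : nat) : 'M[A]_(k + k) :=
  block_mx 0 (antidiag A k) (- antidiag A k) 0.

(* k stands for t - 1, so that k + k = 2t - 2. *)
Section Invariants.
Variables (R : comNzRingType) (k n : nat).
Local Notation m := (k + k)%N.

Definition coordM := {mpoly R[m * n]}.
HB.instance Definition _ := GRing.ComNzRing.on coordM.

Definition genericX : 'M[coordM]_(m, n) :=
  \matrix_(a, i) 'X_(mxvec_index a i).

(* Polynomials in the entries of a generic m x m matrix g and a generic
   m x n matrix x. *)
Definition polyGM := {mpoly R[m * m + m * n]}.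
HB.instance Definition _ := GRing.ComNzRing.on polyGM.

Definition varG : 'M[polyGM]_m :=
  \matrix_(a, b) 'X_(lshift (m * n) (mxvec_index a b)).
Definition varM : 'M[polyGM]_(m, n) :=
  \matrix_(a, i) 'X_(rshift (m * m) (mxvec_index a i)).

Definition symplectic_rel (ab : 'I_m * 'I_m) : polyGM :=
  (varG^T *m Jtilde polyGM k *m varG - Jtilde polyGM k) ab.1 ab.2.

(* The coordinate ring R[G] (x)_R R[M] of the product of G and M over R, where
   R[G] = R[g_ab] / (entries of g^T J~ g - J~). *)
Definition coordGM := quot_gen symplectic_rel.
HB.instance Definition _ := GRing.ComPzRing.on coordGM.

(* The R-algebra morphism from R[M] which substitutes Y for the generic matrix,
   followed by reduction to R[G x M]. *)
Definition subst_GM (Y : 'M[polyGM]_(m, n)) (f : coordM) : coordGM :=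
  quot_class symplectic_rel (mmap (@mpolyC _ R) (fun j => mxvec Y 0 j) f).

Definition pullback_action : coordM -> coordGM := subst_GM (varG *m varM).
Definition pullback_snd : coordM -> coordGM := subst_GM varM.

Definition is_invariant : {pred coordM} :=
  fun f => pullback_action f == pullback_snd f.

Fact is_invariant_subring_closed : subring_closed is_invariant.
Proof.
have subB Y : zmod_morphism (subst_GM Y).
  by move=> f h; rewrite /subst_GM !raddfB.
have sub1 Y : subst_GM Y 1 = 1 by rewrite /subst_GM !rmorph1.
have subM Y : {morph subst_GM Y : f h / f * h}.
  by move=> f h; rewrite /subst_GM !rmorphM.
split=> [|f h /eqP Ef /eqP Eh|f h /eqP Ef /eqP Eh]; apply/eqP.
- by rewrite /pullback_action /pullback_snd !sub1.
- by rewrite /pullback_action /pullback_snd !subB; congr (_ - _).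
- by rewrite /pullback_action /pullback_snd !subM; congr (_ * _).
Qed.

HB.instance Definition _ := GRing.isSubringClosed.Build coordM is_invariant
  is_invariant_subring_closed.

Record invariants := Invariant {
  invariant_val :> coordM;
  _ : invariant_val \in is_invariant }.

HB.instance Definition _ := [isSub for invariant_val].
HB.instance Definition _ := [Choice of invariants by <:].
HB.instance Definition _ := [SubChoice_isSubComNzRing of invariants by <:].

Definition pi_comorphism (p : polyZ R n) : coordM :=
  mmap (@mpolyC _ R)
    (fun j => let ij := val (enum_val j) in
       (genericX^T *m Jtilde coordM k *m genericX) ij.1 ij.2) p.

End Invariants.

(* Main.v *)
Require Import Defs.
From HB Require Import structures.
From mathcomp Require Import all_boot all_order perm all_algebra.
From mathcomp Require Import boolp mpoly.
From mathcomp Require Import ring zify.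
Set Implicit Arguments.
Unset Strict Implicit.
Unset Printing Implicit Defensive.
Import Order.TTheory GRing.Theory.
Local Open Scope ring_scope.

(** Put k = t - 1 and let S be the subring of R[M] generated by the entries
    <x_i, x_j> of the Gram matrix tX J~ X, that is, the image of R[z]. The
    entries of the Gram matrix are invariant ([piM_invariant]), so three things
    are at stake: the Pfaffian ideal is killed in R[M], it is the whole kernel
    of R[z] -> S, and S contains every invariant.

    Standard monomials. A product of Pfaffians is indexed by a tableau, and it
    is standard when its rows increase strictly and its columns weakly. Over
    any ring the standard products span R[z] ([straightening]): where two
    consecutive rows violate the order, an alternating sum over 2r + 1 indices
    rewrites their product by products with a smaller first row, modulo
    Pfaffians of larger size. In R[M] a Pfaffian with more than 2k indices
    vanishes, as the Gram form is a sum of k forms of rank two, while standard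
    products with rows of size at most 2k have pairwise distinct leading
    monomials with coefficient 1 ([std_free]). So the kernel is the Pfaffian
    ideal ([piM_kernel]), and S is free on these standard products.

    Denominators. Let f be invariant, let l consist of 2k columns, and let p be
    the Pfaffian of the Gram matrix Z_l on l. Suppose that H has entries in
    R[z] and tH J~ H = s^2 Z_l. After inverting s p, the matrix
    g = s^-1 H Z_l^-1 tX_l J~ is symplectic and
    g X = s^-1 H Z_l^-1 Z_(l, all) has its entries in S[1/(s p)]; as
    f(g X) = f(X), some (s p)^N f is in S ([clear_denominator]). No single H
    exists globally, because the bundle of symplectic bases of a nondegenerate
    alternating form is not trivial; but symplectic Gram-Schmidt, started from
    every possible entry, shows that p lies in the radical of the ideal of
    these s ([pf_section]). Hence p^N f is in S for some N.

    Descent. Use the last result for the rows a1 = (0, ..., 2k - 1) and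
    a2 = (0, ..., 2k - 2, 2k), which exist because 2k + 2 <= n. The row a1 is
    the least of all rows of size at most 2k, and a2 is the least of the others.
    So putting a1 in front of a standard tableau keeps it standard, and so does
    putting a2 in front of one that does not start with a1: the Pfaffians p1
    and p2 of these rows form a regular sequence on S, and p1^N1 f, p2^N2 f in
    S give f in S ([descent]). *)

(** * Exterior forms as functions on words, and Pfaffians *)

Section Forms.
Variables (A : comNzRingType) (I : eqType).
Implicit Types (F G : seq I -> A) (u v : I -> A) (l : seq I) (x y : I).

(** A form of degree d is represented by its values on words of length d, and
    F (x :: _) is its contraction with x. The recursion says that contraction
    is an antiderivation; it makes the product of the linear form u with F
    computable without any index bookkeeping. *)
Fixpoint lwedge u F l : A :=
  if l is y :: l' then u y * F l' - lwedge u (fun s => F (y :: s)) l' else 0.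

(** The grading involution, by which contraction passes the first factor of a product. *)
Definition ngrade F : seq I -> A := fun s => (-1) ^+ size s * F s.

(** The exterior product, again determined by the antiderivation rule: unfolded,
    it is the signed sum over all splittings of the word into two subwords. *)
Fixpoint wedge F G l : A :=
  if l is y :: l' then
    wedge (fun s => F (y :: s)) G l' + wedge (ngrade F) (fun s => G (y :: s)) l'
  else F [::] * G [::].

Lemma wedge_cons F G y l : wedge F G (y :: l) =
  wedge (fun s => F (y :: s)) G l + wedge (ngrade F) (fun s => G (y :: s)) l.
Proof. by []. Qed.

Lemma lwedge_cons u F y l : lwedge u F (y :: l) =
  u y * F l - lwedge u (fun s => F (y :: s)) l.
Proof. by []. Qed.

Lemma lwedgeD u F G l :
  lwedge u (fun s => F s + G s) l = lwedge u F l + lwedge u G l.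
Proof.
elim: l F G => [|y l IH] F G /=; first by rewrite addr0.
by rewrite IH; ring.
Qed.

Lemma lwedgeZ u c F l : lwedge u (fun s => c * F s) l = c * lwedge u F l.
Proof.
elim: l F => [|y l IH] F /=; first by rewrite mulr0.
by rewrite IH; ring.
Qed.

Lemma lwedgeN u F l : lwedge u (fun s => - F s) l = - lwedge u F l.
Proof.
rewrite -mulN1r -lwedgeZ; congr (lwedge u _ l).
by apply: funext => s; rewrite mulN1r.
Qed.

Lemma lwedgeB u F G l :
  lwedge u (fun s => F s - G s) l = lwedge u F l - lwedge u G l.
Proof. by rewrite lwedgeD lwedgeN. Qed.

Lemma lwedge0 u l : lwedge u (fun=> 0) l = 0.
Proof. by elim: l => //= y l ->; rewrite mulr0 subr0. Qed.

Lemma lwedge_addl u v F l :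
  lwedge (fun x => u x + v x) F l = lwedge u F l + lwedge v F l.
Proof.
elim: l F => [|y l IH] F /=; first by rewrite addr0.
by rewrite IH; ring.
Qed.

Lemma lwedge_scalel c u F l : lwedge (fun x => c * u x) F l = c * lwedge u F l.
Proof.
elim: l F => [|y l IH] F /=; first by rewrite mulr0.
by rewrite IH; ring.
Qed.

Lemma lwedge_anti u v F l : lwedge u (lwedge v F) l = - lwedge v (lwedge u F) l.
Proof.
elim: l F => [|y l IH] F /=; first by rewrite oppr0.
rewrite !lwedgeB !lwedgeZ IH; ring.
Qed.

Lemma lwedge_sq u F l : lwedge u (lwedge u F) l = 0.
Proof.
elim: l F => [|y l IH] F //=.
by rewrite lwedgeB lwedgeZ IH; ring.
Qed.

(** The terms of the product are u x * F s with x moved out of the word, up to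
    sign, so membership in an additive subgroup can be checked on them. *)
Lemma lwedge_closed (J : A -> Prop) u F l :
    J 0 -> (forall a b, J a -> J b -> J (a - b)) ->
    (forall x s, perm_eq (x :: s) l -> J (u x * F s)) ->
  J (lwedge u F l).
Proof.
move=> J0 JB; elim: l F => [|y l IH] F HF //=.
apply: JB; first exact: HF.
apply: IH => x s xsl; apply: HF.
rewrite -(perm_cons y) in xsl; rewrite -(permPr xsl).
by rewrite -[x :: y :: s]/([:: x] ++ [:: y] ++ s) perm_catCA.
Qed.

Lemma ngradeK F : ngrade (ngrade F) = F.
Proof.
by apply: funext => s; rewrite /ngrade mulrA -expr2 sqrr_sign mul1r.
Qed.

Lemma ngrade_cons F y :
  (fun s => ngrade F (y :: s)) = (fun s => - ngrade (fun s => F (y :: s)) s).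
Proof. by apply: funext => s; rewrite /ngrade /= exprS; ring. Qed.

Lemma ngrade_lwedge u F : ngrade (lwedge u F) = (fun s => - lwedge u (ngrade F) s).
Proof.
apply: funext => s; rewrite /ngrade.
elim: s F => [|y s IH] F /=; first by rewrite mulr0 oppr0.
transitivity (- (u y * ((-1) ^+ size s * F s))
    + (-1) ^+ size s * lwedge u (fun s => F (y :: s)) s).
  by rewrite exprS; ring.
by rewrite IH ngrade_cons lwedgeN; ring.
Qed.

Lemma wedgeDl F F' G l :
  wedge (fun s => F s + F' s) G l = wedge F G l + wedge F' G l.
Proof.
elim: l F F' G => [|y l IH] F F' G /=; first by rewrite mulrDl.
have -> : ngrade (fun s => F s + F' s) = (fun s => ngrade F s + ngrade F' s).
  by apply: funext => s; rewrite /ngrade mulrDr.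
by rewrite !IH; ring.
Qed.

Lemma wedgeZl c F G l : wedge (fun s => c * F s) G l = c * wedge F G l.
Proof.
elim: l F G => [|y l IH] F G /=; first by rewrite mulrA.
rewrite IH.
have -> : ngrade (fun s => c * F s) = (fun s => c * ngrade F s).
  by apply: funext => s; rewrite /ngrade mulrCA.
by rewrite !IH; ring.
Qed.

Lemma wedgeNl F G l : wedge (fun s => - F s) G l = - wedge F G l.
Proof.
rewrite -mulN1r -wedgeZl; congr (wedge _ _ l).
by apply: funext => s; rewrite mulN1r.
Qed.

Lemma wedgeDr F G G' l :
  wedge F (fun s => G s + G' s) l = wedge F G l + wedge F G' l.
Proof.
elim: l F G G' => [|y l IH] F G G' /=; first by rewrite mulrDr.
by rewrite !IH; ring.
Qed.

Lemma wedgeZr c F G l : wedge F (fun s => c * G s) l = c * wedge F G l.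
Proof.
elim: l F G => [|y l IH] F G /=; first by rewrite mulrCA.
by rewrite !IH; ring.
Qed.

Lemma wedgeNr F G l : wedge F (fun s => - G s) l = - wedge F G l.
Proof.
rewrite -mulN1r -wedgeZr; congr (wedge _ _ l).
by apply: funext => s; rewrite mulN1r.
Qed.

Lemma wedge0l G l : wedge (fun=> 0) G l = 0.
Proof.
by rewrite (_ : (fun=> 0) = fun s => 0 * (fun=> 0) s) ?wedgeZl ?mul0r.
Qed.

Lemma wedge0r F l : wedge F (fun=> 0) l = 0.
Proof.
by rewrite (_ : (fun=> 0) = fun s => 0 * (fun=> 0) s) ?wedgeZr ?mul0r.
Qed.

Lemma wedge_lwedgel u F G l : wedge (lwedge u F) G l = lwedge u (wedge F G) l.
Proof.
elim: l F G => [|y l IH] F G /=; first by rewrite mul0r.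
rewrite wedgeDl wedgeZl wedgeNl IH ngrade_lwedge wedgeNl IH lwedgeD.
by ring.
Qed.

Lemma wedge_lwedger u F G l :
  wedge F (lwedge u G) l = lwedge u (wedge (ngrade F) G) l.
Proof.
elim: l F G => [|y l IH] F G /=; first by rewrite mulr0.
rewrite wedgeDr wedgeZr wedgeNr !IH lwedgeD ngrade_cons ngradeK.
have -> : wedge (fun s => - ngrade (fun s0 => F (y :: s0)) s) G
   = fun s => - wedge (ngrade (fun s0 => F (y :: s0))) G s.
  by apply: funext => s; rewrite wedgeNl.
by rewrite lwedgeN; ring.
Qed.

Variable z : I -> I -> A.

(** The divided power of exponent q of the 2-form z, characterized by
    the contraction rule i_x z^(q + 1) = z(x, _) z^(q). Its values are Pfaffians,
    this rule being the expansion along the first row. *)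
Fixpoint dpow q : seq I -> A :=
  if q is q'.+1 then
    fun l => if l is x :: l' then lwedge (z x) (dpow q') l' else 0
  else fun l => (nilp l)%:R.

Lemma dpowS q x : (fun s => dpow q.+1 (x :: s)) = lwedge (z x) (dpow q).
Proof. by []. Qed.

Lemma dpow_cons2 q x y s : dpow q.+1 (x :: y :: s) =
  z x y * dpow q s - lwedge (z x) (fun t => dpow q (y :: t)) s.
Proof. by []. Qed.

Lemma dpow_cons q x l : dpow q.+1 (x :: l) = lwedge (z x) (dpow q) l.
Proof. by []. Qed.

Lemma dpow0_cons x : (fun s => dpow 0 (x :: s)) = fun s => 0 * dpow 0 s.
Proof. by apply: funext => s; rewrite mul0r. Qed.

Arguments dpow : simpl never.

Definition pf l := dpow (size l)./2 l.

Lemma lwedge_size u F q l : (forall s, size s != q -> F s = 0) ->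
  size l != q.+1 -> lwedge u F l = 0.
Proof.
elim: l F q => [|y l IH] F q HF //= sl.
rewrite HF ?mulr0 1?sub0r; last by apply: contra sl => /eqP->.
case: q HF sl => [|q] HF sl.
  have -> : (fun s => F (y :: s)) = fun=> 0.
    by apply: funext => s; rewrite HF.
  by rewrite lwedge0 oppr0.
by rewrite (IH _ q) ?oppr0 // => s Hs; apply: HF.
Qed.

Lemma dpow_size q l : size l != q.*2 -> dpow q l = 0.
Proof.
elim: q l => [|q IH] [|x l] // sl.
by apply: (@lwedge_size _ _ q.*2) => // s /IH.
Qed.

Lemma ngrade_dpow q : ngrade (dpow q) = dpow q.
Proof.
apply: funext => s; rewrite /ngrade.
have [->|/dpow_size->] := eqVneq (size s) q.*2; last by rewrite mulr0.
by rewrite -signr_odd odd_double mul1r.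
Qed.

Lemma wedge_dpow0l G l : wedge (dpow 0) G l = G l.
Proof.
elim: l G => [|y l IH] G; first by rewrite /= mul1r.
by rewrite wedge_cons dpow0_cons wedgeZl mul0r add0r ngrade_dpow IH.
Qed.

Lemma wedge_dpow0r F l : wedge F (dpow 0) l = F l.
Proof.
elim: l F => [|y l IH] F; first by rewrite /= mulr1.
by rewrite wedge_cons dpow0_cons wedgeZr mul0r addr0 IH.
Qed.

(** The product rule for divided powers; both sides have the same contractions
    by the Pascal rule. *)
Lemma wedge_dpow p q :
  wedge (dpow p) (dpow q) = fun l => 'C(p + q, p)%:R * dpow (p + q) l.
Proof.
elim: p q => [|p IHp] q.
  by apply: funext => l; rewrite wedge_dpow0l bin0 mul1r.
elim: q => [|q IHq]; apply: funext => l.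
  by rewrite wedge_dpow0r addn0 binn mul1r.
case: l => [|x l]; first by rewrite /= mulr0 [dpow _ _]/(0 : A) mulr0.
rewrite wedge_cons !dpowS ngrade_dpow wedge_lwedgel wedge_lwedger ngrade_dpow.
by rewrite IHp IHq !lwedgeZ !addSn !addnS [in RHS]binS natrD mulrDl addrC.
Qed.

Definition alternating_form F :=
  (forall p x y s, F (p ++ x :: y :: s) = - F (p ++ y :: x :: s)) /\
  (forall p x s, F (p ++ x :: x :: s) = 0).

Lemma alternating_cons F x :
  alternating_form F -> alternating_form (fun s => F (x :: s)).
Proof.
move=> [Fa Fd]; split=> [p y y' s|p y s].
  by rewrite (Fa (x :: p)).
by rewrite (Fd (x :: p)).
Qed.

(** The interchange of two letters commutes with the contractions by the letters
    in front of them, so the case to treat is that of the first two letters. *)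
Lemma alternating_lwedge u F :
  alternating_form F -> alternating_form (lwedge u F).
Proof.
move=> FA; split=> [p x y s|p x s].
  elim: p F FA => [|a p IH] F FA /=.
    have -> : (fun t => F (x :: y :: t)) = fun t => - F (y :: x :: t).
      by apply: funext => t; apply: (FA.1 [::]).
    by rewrite lwedgeN; ring.
  by rewrite FA.1 IH; [ring | apply: alternating_cons].
elim: p F FA => [|a p IH] F FA /=.
  have -> : (fun t => F (x :: x :: t)) = fun=> 0.
    by apply: funext => t; apply: (FA.2 [::]).
  by rewrite lwedge0; ring.
by rewrite FA.2 IH; [ring | apply: alternating_cons].
Qed.

Lemma alternating_front F p x s : alternating_form F ->
  F (p ++ x :: s) = (-1) ^+ size p * F (x :: p ++ s).
Proof.
elim: p F => [|a p IH] F FA; first by rewrite mul1r.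
rewrite /= (IH _ (alternating_cons a FA)) (FA.1 [::]) exprS; ring.
Qed.

Lemma alternating_perm F l l' : alternating_form F -> perm_eq l l' ->
  exists b : bool, F l = (-1) ^+ b * F l'.
Proof.
elim: l' F l => [|x l' IH] F l FA.
  by move=> /perm_nilP->; exists false; rewrite mul1r.
move=> ll'; have xl : x \in l by rewrite (perm_mem ll') mem_head.
case/splitPr: xl ll' => p s; rewrite -cat1s perm_catCA /= perm_cons => psl'.
have [b Hb] := IH _ _ (alternating_cons x FA) psl'.
exists (odd (size p) (+) b).
by rewrite alternating_front // Hb signr_addb signr_odd mulrA.
Qed.

Lemma alternating_dup F l : alternating_form F -> ~~ uniq l -> F l = 0.
Proof.
move=> FA; elim: l F FA => [|x l IH] F FA //=.
rewrite negb_and negbK => /orP[xl|ul]; last by rewrite (IH _ (alternating_cons x FA)).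
case/splitPr: xl => p s.
by rewrite (alternating_front _ _ _ (alternating_cons x FA)) (FA.2 [::]) mulr0.
Qed.

Hypotheses (z_alt : forall x, z x x = 0) (z_anti : forall x y, z x y = - z y x).

Lemma dpow_alternating q : alternating_form (dpow q).
Proof.
elim: q => [|q IH].
  by split=> [[|a p] x y s|[|a p] x s]; rewrite /dpow /= ?oppr0.
have IHa := fun a => alternating_lwedge (z a) IH.
split=> [[|a p] x y s|[|a p] x s].
- rewrite /= !dpow_cons2 z_anti.
  case: q {IH IHa} => [|q].
    by rewrite !dpow0_cons !lwedgeZ; ring.
  by rewrite !dpowS lwedge_anti; ring.
- exact: ((IHa a).1 p).
- rewrite /= dpow_cons2 z_alt.
  case: q {IH IHa} => [|q].
    by rewrite !dpow0_cons !lwedgeZ; ring.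
  by rewrite !dpowS lwedge_sq; ring.
exact: ((IHa a).2 p).
Qed.

End Forms.

Arguments dpow {A I} z q : simpl never.

Section NaturalityOfForms.
Variables (A : comNzRingType) (I : eqType).

Lemma dpow_scale (z : I -> I -> A) w q l :
  dpow (fun x y => w * z x y) q l = w ^+ q * dpow z q l.
Proof.
elim: q l => [|q IH] [|x l]; rewrite ?mul1r //; first by rewrite /dpow mulr0.
rewrite !dpow_cons lwedge_scalel.
have -> : dpow (fun x y => w * z x y) q = fun s => w ^+ q * dpow z q s.
  exact: funext.
by rewrite lwedgeZ exprS mulrA.
Qed.

Lemma lwedge_morph (B : comNzRingType) (f : {rmorphism A -> B}) u F (l : seq I) :
  f (lwedge u F l) = lwedge (fun x => f (u x)) (fun s => f (F s)) l.
Proof.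
by elim: l F => [|y l IH] F /=; rewrite ?rmorph0 // rmorphB rmorphM IH.
Qed.

Lemma dpow_morph (B : comNzRingType) (f : {rmorphism A -> B}) z q (l : seq I) :
  f (dpow z q l) = dpow (fun x y => f (z x y)) q l.
Proof.
elim: q l => [|q IH] [|x l]; rewrite ?dpow_cons ?rmorph0 ?rmorph1 //.
rewrite lwedge_morph.
by congr (lwedge _ _ l); apply: funext => s; rewrite IH.
Qed.

(** One vector of cofactors serves all linear forms u, which is what
    turns the expansion of a Pfaffian into a matrix identity. *)
Lemma lwedge_coef (K : finType) (e : K -> I) F (s : seq K) :
  exists c : K -> A, forall u, lwedge u F (map e s) = \sum_j u (e j) * c j.
Proof.
elim: s F => [|i s IH] F.
  by exists (fun=> 0) => u /=; rewrite big1 // => j _; rewrite mulr0.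
have [c Hc] := IH (fun s => F (e i :: s)).
exists (fun j => (j == i)%:R * F (map e s) - c j) => u /=.
rewrite Hc -[u (e i) * _](_ : \sum_j u (e j) * ((j == i)%:R * F (map e s)) = _).
  by rewrite -sumrB; apply: eq_bigr => j _; rewrite mulrBr.
rewrite (bigD1 i) //= eqxx mul1r big1 ?addr0 // => j /negPf->.
by rewrite mul0r mulr0.
Qed.

(** As (u v)^2 = 0, the exponential of u v + z' is (1 + u v) times the
    exponential of z'. This identity drives both the leading monomials of
    Pfaffians and the Gram-Schmidt step. *)
Lemma dpow_rank2 (z z' : I -> I -> A) (u v : I -> A) q l :
    (forall x y, z x y = u x * v y - v x * u y + z' x y) ->
  dpow z q.+1 l = dpow z' q.+1 l + lwedge u (lwedge v (dpow z' q)) l.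
Proof.
move=> zE.
have zxE x : z x = (fun y => (u x * v y + (- v x) * u y) + z' x y).
  by apply: funext => y; rewrite zE; ring.
have uvE q' x s : lwedge u (lwedge v (dpow z' q')) (x :: s) =
    u x * lwedge v (dpow z' q') s - (v x * lwedge u (dpow z' q') s
    - lwedge u (lwedge v (fun t => dpow z' q' (x :: t))) s).
  by rewrite /= lwedgeB lwedgeZ.
elim: q l => [|q IH] [|x l]; rewrite ?addr0 // !dpow_cons zxE uvE.
  have -> : lwedge v (fun t => dpow z' 0 (x :: t)) = fun=> 0.
    by apply: funext => s; rewrite dpow0_cons lwedgeZ mul0r.
  rewrite !lwedge_addl !lwedge_scalel lwedge0.
  by rewrite [dpow z 0]/(dpow z' 0); ring.
have -> : dpow z q.+1 =
    (fun s => dpow z' q.+1 s + lwedge u (lwedge v (dpow z' q)) s).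
  exact: funext.
have vu s : lwedge v (lwedge u (lwedge v (dpow z' q))) s = 0.
  rewrite lwedge_anti (_ : lwedge v (lwedge v _) = fun=> 0) ?lwedge0 ?oppr0 //.
  by apply: funext => t; rewrite lwedge_sq.
have uvz s : lwedge u (lwedge v (lwedge (z' x) (dpow z' q))) s =
    lwedge (z' x) (lwedge u (lwedge v (dpow z' q))) s.
  rewrite [RHS]lwedge_anti -lwedgeN; congr (lwedge u _ s).
  by apply: funext => t; rewrite lwedge_anti.
rewrite dpowS uvz !lwedge_addl !lwedge_scalel !lwedgeD vu lwedge_sq; ring.
Qed.

End NaturalityOfForms.

(** * The exchange relation modulo longer Pfaffians *)

Section Garnir.
Variables (A : comNzRingType) (I : eqType) (z : I -> I -> A).
Implicit Types (F G : seq I -> A) (D E l a b : seq I) (x y : I).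

Definition lwedges D F : seq I -> A := foldr (fun x H => lwedge (z x) H) F D.

Lemma lwedges_cat D E F : lwedges (D ++ E) F = lwedges D (lwedges E F).
Proof. exact: foldr_cat. Qed.

Lemma lwedgesB D F G l :
  lwedges D (fun s => F s - G s) l = lwedges D F l - lwedges D G l.
Proof.
elim: D l => [|d D IH] l //=.
by rewrite -lwedgeB; congr (lwedge _ _ l); apply: funext.
Qed.

Lemma lwedgesZ D c F l :
  lwedges D (fun s => c * F s) l = c * lwedges D F l.
Proof.
elim: D l => [|d D IH] l //=.
by rewrite -lwedgeZ; congr (lwedge _ _ l); apply: funext.
Qed.

Lemma lwedges0 D l : lwedges D (fun=> 0) l = 0.
Proof.
elim: D l => [|d D IH] l //=.
by rewrite (_ : lwedges D _ = fun=> 0) ?lwedge0 //; apply: funext.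
Qed.

Lemma wedge_lwedges D E p q :
  wedge (lwedges D (dpow z p)) (lwedges E (dpow z q)) =
  fun l => 'C(p + q, p)%:R * lwedges (D ++ E) (dpow z (p + q)) l.
Proof.
elim: D => [|d D IH] /=; last first.
  by apply: funext => l; rewrite wedge_lwedgel IH lwedgeZ.
elim: E => [|e E IH] /=; first exact: wedge_dpow.
by apply: funext => l; rewrite wedge_lwedger ngrade_dpow IH lwedgeZ.
Qed.

(** The part of i_x (l_D F) in which x is contracted with one of the linear forms. *)
Fixpoint contractions x F D l : A :=
  if D is d :: D' then
    z d x * lwedges D' F l - lwedge (z d) (contractions x F D') l
  else 0.

Lemma lwedges_cons D F x l : lwedges D F (x :: l) =
  contractions x F D l + (-1) ^+ size D * lwedges D (fun s => F (x :: s)) l.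
Proof.
elim: D l => [|d D IH] l /=; first by rewrite add0r mul1r.
have -> : (fun s => lwedges D F (x :: s)) = (fun s => contractions x F D s +
    (-1) ^+ size D * lwedges D (fun s => F (x :: s)) s) by apply: funext.
by rewrite lwedgeD lwedgeZ exprS; ring.
Qed.

Variables (r : nat) (J : nat -> A -> Prop).
Hypotheses (J0 : forall e, J e 0)
  (JB : forall e c c', J e c -> J e c' -> J e (c - c'))
  (Jz : forall e x y c, J e c -> J e.+1 (z x y * c))
  (Jdpow : forall q l, (r < q)%N -> J q (dpow z q l)).

Let JN e c : J e c -> J e (- c).
Proof. by move=> Jc; rewrite -sub0r; apply: JB. Qed.

Let JD e c c' : J e c -> J e c' -> J e (c + c').
Proof. by move=> Jc Jc'; rewrite -[c']opprK; apply: JB => //; apply: JN. Qed.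

Let Jsign e k c : J e c -> J e ((-1) ^+ k * c).
Proof.
by move=> Jc; rewrite -signr_odd; case: odd; rewrite ?mul1r ?mulN1r //; apply: JN.
Qed.

Let Jnat e k c : J e c -> J e (k%:R * c).
Proof.
move=> Jc; elim: k => [|k IH]; first by rewrite mul0r.
by rewrite -addn1 natrD mulrDl mul1r; apply: JD.
Qed.

Lemma contractions_closed n e F x :
    (forall E l, size E = n -> J e (lwedges E F l)) ->
  forall D E l, (size E + size D = n.+1)%N ->
    J e.+1 (lwedges E (contractions x F D) l).
Proof.
move=> JF; elim=> [|d D IH] E l /= sED.
  by rewrite lwedges0.
rewrite -/(contractions x F D).
rewrite lwedgesB lwedgesZ; apply: JB.
  by apply: Jz; rewrite -lwedges_cat; apply: JF; rewrite size_cat; lia.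
have -> : lwedges E (lwedge (z d) (contractions x F D)) =
    lwedges (E ++ [:: d]) (contractions x F D) by rewrite lwedges_cat.
by apply: IH; rewrite size_cat /=; lia.
Qed.

(** Consider J as the ideal of the Pfaffians of size above 2r, graded by the
    degree in z. Then a product of linear forms z(d, _) and a divided power
    of z, of total degree above 2r, vanishes modulo J: a linear form next to
    z^(q) is the contraction of z^(q + 1), and moving this contraction
    to the front leaves terms with fewer linear forms. *)
Lemma lwedges_dpow_closed D q l : (r.*2 < size D + q.*2)%N ->
  J (size D + q) (lwedges D (dpow z q) l).
Proof.
have [n] := ubnP (size D); elim: n D q l => // n IH D q l.
case/lastP: D => [|D x]; first by move=> _ ?; apply: Jdpow; lia.
rewrite size_rcons ltnS => sD rD.
(* the innermost linear form turns dpow z q into the contraction of dpow z q.+1 *)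
have -> : lwedges (rcons D x) (dpow z q) l =
    (-1) ^+ size D *
      (lwedges D (dpow z q.+1) (x :: l) - contractions x (dpow z q.+1) D l).
  rewrite lwedges_cons addrC addKr mulrA -expr2 sqrr_sign mul1r.
  by rewrite -cats1 lwedges_cat.
apply/Jsign/JB.
  by rewrite addSnnS; apply: IH; lia.
case: D sD rD => [|d D] sD rD //.
rewrite -[contractions _ _ _ _]/(lwedges [::] (contractions x (dpow z q.+1) (d :: D)) l).
rewrite [size (d :: D)]/= addSn.
apply: (@contractions_closed (size D)) => // E l' sE.
rewrite addSnnS -sE; apply: IH; rewrite /= in sD rD *; lia.
Qed.

(** What contraction and exterior product make of the divided powers of z:
    combinations of products of linear forms z(d, _) and a divided power. The
    index e is the degree in the entries of z, and d the degree as a form. *)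
Inductive homform : nat -> nat -> (seq I -> A) -> Prop :=
| Homform0 e d : homform e d (fun=> 0)
| HomformGen D q : homform (size D + q) (size D + q.*2) (lwedges D (dpow z q))
| HomformB e d F G :
    homform e d F -> homform e d G -> homform e d (fun s => F s - G s)
| HomformZ e d x y F : homform e d F -> homform e.+1 d (fun s => z x y * F s).

Lemma homform_lwedge e d F x :
  homform e d F -> homform e.+1 d.+1 (lwedge (z x) F).
Proof.
elim=> {e d F} [e d|D q|e d F G _ IHF _ IHG|e d y y' F _ IH].
- rewrite (_ : lwedge _ _ = fun=> 0); first exact: Homform0.
  by apply: funext => s; rewrite lwedge0.
- exact: (HomformGen (x :: D) q).
- rewrite (_ : lwedge _ _ = fun s => lwedge (z x) F s - lwedge (z x) G s).
    exact: HomformB.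
  by apply: funext => s; rewrite lwedgeB.
rewrite (_ : lwedge _ _ = fun s => z y y' * lwedge (z x) F s).
  exact: HomformZ.
by apply: funext => s; rewrite lwedgeZ.
Qed.

Lemma homform_cons e d F x : homform e d F -> homform e d.-1 (fun s => F (x :: s)).
Proof.
elim=> {e d F} [e d|D q|e d F G _ IHF _ IHG|e d y y' F _ IH].
- exact: Homform0.
- elim: D => [|d D IH] /=.
    case: q => [|q]; last by rewrite dpowS; apply: (HomformGen [:: x] q).
    rewrite dpow0_cons (_ : (fun s => _) = fun=> 0); first exact: Homform0.
    by apply: funext => s; rewrite mul0r.
  apply: HomformB; first exact/HomformZ/HomformGen.
  have [Dq0|Dq0] := posnP (size D + q.*2); last first.
    by rewrite -(prednK Dq0); apply: homform_lwedge.
  have [-> ->] : D = [::] /\ q = 0%N by case: D {IH} Dq0 => // Dq0; split=> //; lia.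
  rewrite [lwedge _ _](_ : _ = fun=> 0); first exact: Homform0.
  by apply: funext => s; rewrite /= dpow0_cons lwedgeZ mul0r.
- exact: HomformB.
exact: HomformZ.
Qed.

Lemma homform_cat e d F a :
  homform e d F -> homform e (d - size a) (fun s => F (a ++ s)).
Proof.
elim: a e d F => [|x a IH] e d F HF /=; first by rewrite subn0.
have -> : (d - (size a).+1 = d.-1 - size a)%N by lia.
exact: (IH _ _ (fun s => F (x :: s)) (homform_cons x HF)).
Qed.

Lemma homform_wedge e d F e' d' G l : homform e d F -> homform e' d' G ->
  (r.*2 < d + d')%N -> J (e + e') (wedge F G l).
Proof.
move=> HF; elim: HF e' d' G l =>
  {e d F} [e d|D q|e d F F' _ IHF _ IHG|e d y y' F _ IH] e' d' G l HG dd.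
- by rewrite wedge0l.
- elim: HG dd => {e' d' G} [e d|E p|e d F F' _ IHF _ IHG|e d y y' F _ IH] dd.
  + by rewrite wedge0r.
  + rewrite wedge_lwedges addnACA -size_cat; apply/Jnat/lwedges_dpow_closed.
    by rewrite size_cat; lia.
  + by rewrite wedgeDr wedgeNr; apply: JB; [apply: IHF | apply: IHG].
  by rewrite wedgeZr addnS; apply/Jz/IH.
- by rewrite wedgeDl wedgeNl; apply: JB; [apply: IHF HG _ | apply: IHG HG _].
by rewrite wedgeZl; apply/Jz/(IH _ _ _ _ HG).
Qed.

(** The exchange relation: shuffling more than 2r letters over two Pfaffians
    gives zero modulo Pfaffians of size above 2r. Both factors are
    contractions of divided powers, so their product is a combination of
    the forms treated in [lwedges_dpow_closed]. *)
Lemma wedge_dpow_cat_closed q q' a b l :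
    (size a <= q.*2)%N -> (size b <= q'.*2)%N ->
    (r.*2 + size a + size b < q.*2 + q'.*2)%N ->
  J (q + q')
    (wedge (fun s => dpow z q (a ++ s)) (fun s => dpow z q' (b ++ s)) l).
Proof.
move=> sa sb rab.
have hf c p : (size c <= p.*2)%N ->
    homform p (p.*2 - size c) (fun s => dpow z p (c ++ s)).
  by move=> _; apply: homform_cat; apply: (HomformGen [::] p).
by apply: (homform_wedge _ (hf _ _ sa) (hf _ _ sb)); lia.
Qed.

End Garnir.

Section WedgeClosed.
Variables (A : comNzRingType) (I : eqType) (Q : A -> Prop).
Hypotheses (Q0 : Q 0) (QB : forall c c', Q c -> Q c' -> Q (c - c')).
Implicit Types (F G : seq I -> A) (l a b s t : seq I).

Let QN c : Q c -> Q (- c).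
Proof. by move=> Qc; rewrite -sub0r; apply: QB. Qed.

Let QD c c' : Q c -> Q c' -> Q (c + c').
Proof. by move=> Qc Qc'; rewrite -[c']opprK; apply: QB => //; apply: QN. Qed.

Let Qsign k c : Q c -> Q ((-1) ^+ k * c).
Proof.
by move=> Qc; rewrite -signr_odd; case: odd; rewrite ?mul1r ?mulN1r //; apply: QN.
Qed.

Lemma wedge_closed F G l :
    (forall s t, perm_eq (s ++ t) l -> Q (F s * G t)) ->
  Q (wedge F G l).
Proof.
elim: l F G => [|y l IH] F G HFG; first exact: HFG.
rewrite wedge_cons; apply: QD; apply: IH => s t st.
  by apply: HFG; rewrite /= perm_cons.
rewrite /ngrade -mulrA; apply/Qsign/HFG.
by rewrite -cat1s perm_catCA /= perm_cons.
Qed.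

End WedgeClosed.

Section WedgeSplit.
Variables (A : comNzRingType) (I : eqType).
Implicit Types (F G : seq I -> A) (l a b s t : seq I).

(** As F is concentrated in degree size a, only the splitting with an empty second part counts. *)
Lemma wedge_top F G a : (forall s, size s != size a -> F s = 0) ->
  wedge F G a = F a * G [::].
Proof.
elim: a F G => [|x a IH] F G HF //; rewrite wedge_cons IH; last first.
  by move=> s sa; apply: HF; rewrite /= eqSS.
rewrite -[RHS]addr0; congr (_ + _).
apply: (wedge_closed (Q := fun c => c = 0)) => // [c c' -> ->|s t].
  by rewrite subr0.
move=> /perm_size; rewrite size_cat => sa.
by rewrite /ngrade HF ?mulr0 ?mul0r //=; lia.
Qed.

Variable Q : A -> Prop.
Hypotheses (Q0 : Q 0) (QB : forall c c', Q c -> Q c' -> Q (c - c')).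

Let Qsign k c : Q c -> Q ((-1) ^+ k * c).
Proof.
move=> Qc; rewrite -signr_odd; case: odd; rewrite ?mul1r ?mulN1r //.
by rewrite -sub0r; apply: QB.
Qed.

(** Isolates one splitting of b ++ a in the signed sum, the one that gives a to
    F and b to G; every other contributing one gives a letter of b to F. *)
Lemma wedge_extract F G a b :
    (forall s, size s != size a -> F s = 0) ->
    Q (wedge F G (b ++ a)) ->
    (forall s t, size s = size a -> perm_eq (s ++ t) (b ++ a) ->
       has (mem b) s -> Q (F s * G t)) ->
  Q (F a * G b).
Proof.
elim: b F G => [|y b IH] F G HF; first by rewrite wedge_top.
rewrite cat_cons wedge_cons => QFG Hst.
have Q1 : Q (wedge (fun s => F (y :: s)) G (b ++ a)).
  apply: (wedge_closed Q0 QB) => s t st.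
  have [sa|/HF->] := eqVneq (size (y :: s)) (size a); last by rewrite mul0r.
  by apply: Hst => //=; rewrite ?perm_cons // inE eqxx.
have : Q (ngrade F a * G (y :: b)).
  apply: (IH (ngrade F) (fun t => G (y :: t))) => [s sa||s t sa st bs].
  - by rewrite /ngrade HF ?mulr0.
  - by have := QB QFG Q1; rewrite addrC addKr.
  rewrite /ngrade -mulrA; apply/Qsign/Hst => //.
    by rewrite -cat1s perm_catCA /= perm_cons.
  by apply: sub_has bs => x /= xb; rewrite inE xb orbT.
by move/(Qsign (size a)); rewrite /ngrade -mulrA signrMK.
Qed.

End WedgeSplit.

(** * Straightening *)

Section Span.
Variable A : zmodType.

Inductive zspan (S : A -> Prop) : A -> Prop :=
| Zspan0 : zspan S 0
| ZspanGen x : S x -> zspan S x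
| ZspanB x y : zspan S x -> zspan S y -> zspan S (x - y).

End Span.

Section Tableaux.
Variable n : nat.
Implicit Types (a b c : seq 'I_n) (T U : seq (seq 'I_n)).

Definition incr a := sorted (fun i j : 'I_n => (i < j)%N) a.

(** The order on rows in which longer rows come first, since the exchange
    relation produces longer Pfaffians in front. *)
Fixpoint row_le a b :=
  match a, b with
  | x :: a', y :: b' => (x <= y)%N && row_le a' b'
  | _, [::] => true
  | [::], _ => false
  end.

Definition pfrow a := [&& incr a, ~~ odd (size a) & a != [::]].
Definition std T := all pfrow T && sorted row_le T.
Definition tabdeg T := (\sum_(a <- T) (size a)./2)%N.
Definition even_rows T := all (fun a => ~~ odd (size a) && (0 < size a)%N) T.
Definition rowsum a := (\sum_(i <- a) i)%N.

Lemma row_leN a b : ~~ row_le a b -> (size b <= size a)%N ->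
  exists a1 x a2 b1 y b2,
    [/\ a = a1 ++ x :: a2, b = b1 ++ y :: b2, size a1 = size b1 & (y < x)%N].
Proof.
elim: a b => [|x a IH] [|y b] //=.
rewrite negb_and -ltnNge => /orP[yx _|ab].
  by exists [::], x, a, [::], y, b.
rewrite ltnS => /(IH _ ab)[a1 [x' [a2 [b1 [y' [b2 [-> -> s12 yx]]]]]]].
by exists (x :: a1), x', a2, (y :: b1), y', b2; rewrite /= s12.
Qed.

(** With i - x truncated at 0, the sum of the i - x over s ++ t is that over a,
    since the letters of b lie below x; and a letter of b in s makes the sum
    over s strictly smaller than what this bound allows. *)
Lemma rowsum_exchange x s t a b : perm_eq (s ++ t) (b ++ a) ->
    size s = size a -> all (fun i : 'I_n => (i < x)%N) b ->
    all (fun i : 'I_n => (x <= i)%N) a -> has (mem b) s ->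
  (rowsum s < rowsum a)%N.
Proof.
move=> st sa /allP bx /allP ax bs.
have Ea : rowsum a = (size a * x + \sum_(i <- a) (i - x))%N.
  rewrite /rowsum; elim: a ax {st sa} => [|i a IH] ax; first by rewrite !big_nil.
  rewrite !big_cons IH => [|j ja]; last by apply: ax; rewrite inE ja orbT.
  by have := ax i (mem_head _ _); rewrite /= mulSn; lia.
have Es : (rowsum s < size s * x + \sum_(i <- s) (i - x))%N.
  have Ele u : (rowsum u <= size u * x + \sum_(i <- u) (i - x))%N.
    elim: u => [|i u IH]; rewrite /rowsum ?big_nil // !big_cons.
    by move: IH; rewrite /rowsum /= mulSn; lia.
  have /hasP[i /splitPr[s1 s2] ib] := bs.
  have := Ele s1; have := Ele s2; have := bx i ib.
  by rewrite /rowsum !big_cat !big_cons size_cat /= mulnDl mulSn; lia.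
apply: (leq_trans Es); rewrite Ea sa leq_add2l.
have := perm_big _ st (op := addn) (x := 0%N) (P := xpredT)
  (F := fun i : 'I_n => (i - x)%N).
rewrite !big_cat /= [X in _ = (X + _)%N -> _]big1_seq ?add0n => [<-|i ib].
  exact: leq_addr.
by apply/eqP; rewrite subn_eq0 ltnW // bx.
Qed.

Lemma incr_pairwise a : incr a = pairwise (fun i j : 'I_n => (i < j)%N) a.
Proof. by apply: sorted_pairwise => j i k; apply: ltn_trans. Qed.

Lemma uniq_incr a : uniq a -> exists2 a', perm_eq a a' & incr a'.
Proof.
move=> ua; pose a' := sort (fun i j : 'I_n => (i <= j)%N) a.
have a'a : perm_eq a' a by rewrite /a' perm_sort.
exists a'; first by rewrite perm_sym.
have := ltn_sorted_uniq_leq (map val a').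
rewrite !sorted_map map_inj_uniq ?(perm_uniq a'a) ?ua; last exact: val_inj.
rewrite (sort_sorted (fun i j : 'I_n => leq_total i j)) => H.
by rewrite /incr H.
Qed.

Variables (A : comNzRingType) (z : 'I_n -> 'I_n -> A).
Hypotheses (z_alt : forall x, z x x = 0) (z_anti : forall x y, z x y = - z y x).

Definition tabprod T : A := \prod_(a <- T) pf z a.

Lemma tabprod_cons a T : tabprod (a :: T) = pf z a * tabprod T.
Proof. exact: big_cons. Qed.

Lemma tabprod_cat T U : tabprod (T ++ U) = tabprod T * tabprod U.
Proof. exact: big_cat. Qed.

Lemma tabdeg0 : tabdeg [::] = 0%N.
Proof. exact: big_nil. Qed.

Lemma tabdeg_cons a T : tabdeg (a :: T) = ((size a)./2 + tabdeg T)%N.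
Proof. exact: big_cons. Qed.

Lemma tabdeg_cat T U : tabdeg (T ++ U) = (tabdeg T + tabdeg U)%N.
Proof. exact: big_cat. Qed.

(** At the first violation a_h > b_h, shuffle b_0 < ... < b_h < a_h < ... over
    the two rows: these are size a + 1 letters, and any nontrivial exchange
    replaces letters of a by smaller ones. *)
Lemma pf_exchange (Q : A -> Prop) a b :
    Q 0 -> (forall f f', Q f -> Q f' -> Q (f - f')) ->
    incr a -> incr b -> ~~ odd (size a) -> ~~ odd (size b) ->
    (size b <= size a)%N -> ~~ row_le a b ->
    (forall a' b', size a' = size a -> size b' = size b ->
       (rowsum a' < rowsum a)%N -> Q (pf z a' * pf z b')) ->
    (forall c T, even_rows (c :: T) -> tabdeg (c :: T) = tabdeg [:: a; b] ->
       (size a < size c)%N -> Q (tabprod (c :: T))) ->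
  Q (pf z a * pf z b).
Proof.
move=> Q0 QB inca incb ea eb ba /row_leN /(_ ba).
case=> [a1 [x [a2 [b1 [y [b2 [Ea Eb s12 yx]]]]]]] Qex Qlong.
set r := (size a)./2; set q := (size b)./2.
have sa : r.*2 = size a by rewrite even_halfK.
have sb : q.*2 = size b by rewrite even_halfK.
(* the ideal of the Pfaffians longer than a, graded by the degree in z *)
pose J e := zspan (fun f : A => exists d T, [/\ even_rows (d :: T),
  tabdeg (d :: T) = e, (size a < size d)%N & f = tabprod (d :: T)]).
have JQ e (f : A) : e = (r + q)%N -> J e f -> Q f.
  move=> -> Jf; elim: Jf => // [_ [d [T [ed Td sd ->]]]|? ? _ ? _ ?]; last exact: QB.
  by apply: Qlong => //; rewrite Td /tabdeg !big_cons big_nil addn0.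
have J0 e : J e 0 by exact: Zspan0.
have JB e f f' : J e f -> J e f' -> J e (f - f') by exact: ZspanB.
have Jz e i j f : J e f -> J e.+1 (z i j * f).
  move=> Jf; elim: Jf => [|_ [d [T [/= /andP[/andP[ed _] eT] Td sd ->]]]|? ? _ ? _ ?].
  - by rewrite mulr0.
  - apply: ZspanGen.
    exists d, ([:: i; j] :: T); split=> //=; first by rewrite ed (leq_ltn_trans _ sd).
      by move: Td; rewrite !tabdeg_cons /=; lia.
    by rewrite !tabprod_cons mulrCA /pf /dpow /=; ring.
  by rewrite mulrBr; apply: JB.
have Jdpow p l : (r < p)%N -> J p (dpow z p l).
  have [lp rp|/dpow_size-> //] := eqVneq (size l) p.*2.
  apply: ZspanGen; exists l, [::]; split.
  - by rewrite /even_rows /= lp odd_double double_gt0 (leq_ltn_trans _ rp).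
  - by rewrite /tabdeg big_cons big_nil addn0 lp doubleK.
  - by rewrite lp -sa; lia.
  by rewrite tabprod_cons /tabprod big_nil mulr1 /pf lp doubleK.
have szE : (size a = size a1 + (size a2).+1)%N by rewrite Ea size_cat.
have szbE : (size b = size b1 + (size b2).+1)%N by rewrite Eb size_cat.
have QJ : Q (wedge (fun s => dpow z r (a1 ++ s)) (fun s => dpow z q (b2 ++ s))
    (rcons b1 y ++ x :: a2)).
  apply: (JQ (r + q)%N) => //; apply: (wedge_dpow_cat_closed J0 JB Jz Jdpow).
  - by rewrite sa szE leq_addr.
  - by rewrite sb szbE addnS -addSn leq_addl.
  by rewrite -addnA ltn_add2l sb szbE s12 addnS ltnS.
have a2x : all (fun i : 'I_n => (x <= i)%N) (x :: a2).
  move: inca; rewrite incr_pairwise Ea pairwise_cat pairwise_cons.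
  case/and4P=> _ _ /allP xa2 _; rewrite /= leqnn.
  by apply/allP => i /xa2; apply: ltnW.
have b1x : all (fun i : 'I_n => (i < x)%N) (rcons b1 y).
  move: incb; rewrite incr_pairwise Eb pairwise_cat allrel_consr.
  case/andP=> /andP[/allP b1y _] _; rewrite all_rcons yx.
  by apply/allP => i /b1y /= iy; apply: ltn_trans iy yx.
have : Q (dpow z r (a1 ++ x :: a2) * dpow z q (b2 ++ rcons b1 y)).
  apply: (wedge_extract Q0 QB (F := fun s => dpow z r (a1 ++ s))
      (G := fun s => dpow z q (b2 ++ s)) _ QJ) => [s ss|s t ss st bs].
    apply: dpow_size; rewrite sa szE size_cat.
    by apply: contra ss; rewrite eqn_add2l.
  have sst := perm_size st; rewrite !size_cat size_rcons in sst.
  have Es : size (a1 ++ s) = size a by rewrite size_cat ss szE.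
  have Et : size (b2 ++ t) = size b by rewrite size_cat szbE; move: ss sst => /= ->; lia.
  have := Qex _ _ Es Et; rewrite /pf Es Et; apply.
  rewrite /rowsum Ea !big_cat ltn_add2l.
  exact: rowsum_exchange st ss b1x a2x bs.
have bperm : perm_eq (b2 ++ rcons b1 y) b.
  by rewrite Eb -cat_rcons perm_catC.
have [e ->] := alternating_perm (dpow_alternating z_alt z_anti q) bperm.
rewrite -Ea mulrCA; case: e; rewrite ?mul1r // mulN1r => /(QB _ _ Q0).
by rewrite sub0r opprK.
Qed.

Definition std_span d : A -> Prop :=
  zspan (fun f => exists T, [/\ std T, tabdeg T = d & f = tabprod T]).

Lemma even_rows_std T : std T -> even_rows T.
Proof.
case/andP => /allP pT _; apply/allP => a /pT /and3P[_ -> a0].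
by rewrite lt0n size_eq0.
Qed.

(** Induction on the degree, then downwards on the size of the first row, then
    on the sum of its entries. By the degree induction the rows below the first
    may be taken standard, so only the first two rows can be out of
    order; a longer second row is moved to the front, and otherwise
    [pf_exchange] applies. *)
Lemma straightening T : even_rows T -> std_span (tabdeg T) (tabprod T).
Proof.
have [d] := ubnP (tabdeg T); elim: d T => // d IHd T; rewrite ltnS => Td eT.
case: T eT Td => [_ _|a T /= /andP[/andP[ea a0] eT] Td].
  by apply: ZspanGen; exists [::].
have [e] := ubnP (d - (size a)./2)%N.
elim: e a ea a0 T eT Td => // e IHe a ea a0 T eT Td.
have [m] := ubnP (rowsum a).
elim: m a ea a0 T eT Td => // m IHm a ea a0 T eT Td am ae.
have span0 d' : std_span d' 0 by exact: Zspan0.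
have spanB d' f g : std_span d' f -> std_span d' g -> std_span d' (f - g).
  exact: ZspanB.
have spanN d' f : std_span d' f -> std_span d' (- f).
  by rewrite -sub0r; apply: spanB.
rewrite tabdeg_cons tabprod_cons in Td *.
(* the head row may be sorted, and is a zero factor if it has repetitions *)
wlog inca : a ea a0 Td am ae / incr a.
  move=> W; have [ua|ua] := boolP (uniq a); last first.
    rewrite [pf z a](alternating_dup (dpow_alternating z_alt z_anti _)) //.
    by rewrite mul0r.
  have [a' aa' inca'] := uniq_incr ua; have a'a : perm_eq a' a by rewrite perm_sym.
  have [b Eb] := alternating_perm (dpow_alternating z_alt z_anti (size a)./2) aa'.
  have := W a'; rewrite /rowsum (perm_big _ a'a) /= /pf !(perm_size a'a) Eb.
  move=> /(_ ea a0 Td am ae inca') H.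
  by case: b {Eb}; rewrite ?mul1r // mulN1r mulNr; apply: spanN.
suff Hstd U : std U -> tabdeg U = tabdeg T ->
    std_span ((size a)./2 + tabdeg T) (pf z a * tabprod U).
  have HT : std_span (tabdeg T) (tabprod T) by apply: IHd => //; lia.
  elim: HT => [|_ [U [stdU UT ->]]|f g _ IHf _ IHg]; first by rewrite mulr0.
    exact: Hstd.
  by rewrite mulrBr; apply: spanB.
move=> stdU; have eU := even_rows_std stdU; move: eU stdU.
case: U => [|b U] eU stdU UT.
  apply: ZspanGen; exists [:: a]; split.
  - by rewrite /std /pfrow /= inca ea -size_eq0 -lt0n a0.
  - by rewrite tabdeg_cons UT.
  by rewrite tabprod_cons.
case/andP: eU => /andP[eb b0] eU; rewrite tabdeg_cons in UT.
have [ab|ba] := ltnP (size a) (size b).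
  have : std_span ((size a)./2 + tabdeg U) (tabprod (a :: U)).
    rewrite -tabdeg_cons; apply: IHd; first by rewrite tabdeg_cons; lia.
    by rewrite /even_rows /= ea a0.
  rewrite tabprod_cons [tabprod (b :: U)]tabprod_cons mulrCA.
  elim=> [|_ [V [stdV VU ->]]|f g _ IHf _ IHg]; first by rewrite mulr0.
    rewrite -tabprod_cons -UT addnCA -VU -tabdeg_cons.
    apply: IHe => //; first exact: even_rows_std.
      by rewrite tabdeg_cons; lia.
    by lia.
  by rewrite mulrBr; apply: spanB.
have [le_ab|nab] := boolP (row_le a b).
  apply: ZspanGen; exists (a :: b :: U); split.
  - case/andP: stdU => /= rU sU; apply/andP; split; last by rewrite /= le_ab.
    by rewrite /= rU /pfrow inca ea -size_eq0 -lt0n a0.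
  - by rewrite !tabdeg_cons UT.
  by rewrite [RHS]tabprod_cons.
rewrite [tabprod (b :: U)]tabprod_cons mulrA -UT.
pose Q f := std_span ((size a)./2 + ((size b)./2 + tabdeg U)) (f * tabprod U).
have incb : incr b by case/andP: stdU => /= /andP[/and3P[]].
apply: (pf_exchange (Q := Q)) => // [||a' b' sa sb a'a|c V eV Vd ac]; rewrite /Q.
- by rewrite mul0r.
- by move=> f g Qf Qg; rewrite mulrBl; apply: spanB.
- rewrite -mulrA -!tabprod_cons -{1}sa -{1}sb -!tabdeg_cons.
  apply: IHm; rewrite ?sa //; first by rewrite /= sb eb b0.
    by rewrite !tabdeg_cons sb sa; lia.
  by lia.
have -> : ((size a)./2 + ((size b)./2 + tabdeg U) = tabdeg (c :: V ++ U))%N.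
  by move: Vd; rewrite !tabdeg_cons tabdeg_cat tabdeg0; lia.
rewrite -tabprod_cat cat_cons; case/andP: eV => /andP[ec c0] eV.
apply: IHe => //.
- by rewrite /even_rows all_cat; apply/andP.
- by move: Vd; rewrite !tabdeg_cons tabdeg_cat tabdeg0; lia.
by move: Vd; rewrite !tabdeg_cons tabdeg0; lia.
Qed.

End Tableaux.

(** * Leading monomials and linear independence *)

Section Leading.
Variables (R : comNzRingType) (N : nat).
Implicit Types (p q r : {mpoly R[N]}) (m : 'X_{1..N}).

(** The coefficient 1 makes leading monomials multiplicative over any ring. *)
Definition leads p m := mlead p = m /\ p@_m = 1.

Lemma leadsX m : leads 'X_[m] m.
Proof. by split; [exact: mleadXm | rewrite mcoeffX eqxx]. Qed.

Lemma leads1 : leads 1 0%MM.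
Proof. by rewrite -mpolyX0; apply: leadsX. Qed.

Lemma leadsM p q m m' : leads p m -> leads q m' -> leads (p * q) (m + m')%MM.
Proof.
move=> [Ep cp] [Eq cq].
have nz : mleadc p * mleadc q != 0 by rewrite Ep Eq cp cq mulr1 oner_neq0.
split; first by rewrite mleadM_proper // Ep Eq.
by have := mleadcM_proper nz; rewrite mleadM_proper // Ep Eq cp cq mulr1.
Qed.

Lemma leads_lreg p m : leads p m -> GRing.lreg p.
Proof. by case=> Ep cp; apply: lreg_mleadc; rewrite Ep cp; apply: lreg1. Qed.

(** Homogeneity is part of the definition because monomials are compared by
    degree first. *)
Definition lowpart (t e : nat) p :=
  forall m, m \in msupp p -> mdeg m = e /\ forall j : 'I_N, (j < t)%N -> m j = 0%N.

Lemma lowpart0 t e : lowpart t e 0.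
Proof. by move=> m; rewrite msupp0. Qed.

Lemma lowpartB t e p q : lowpart t e p -> lowpart t e q -> lowpart t e (p - q).
Proof.
move=> Hp Hq m /msuppB_le; rewrite mem_cat => /orP[]; [exact: Hp | exact: Hq].
Qed.

Lemma lowpartM t e e' p q :
  lowpart t e p -> lowpart t e' q -> lowpart t (e + e') (p * q).
Proof.
move=> Hp Hq m /msuppM_le /allpairsP[[m1 m2] /= [/Hp[d1 H1] /Hq[d2 H2] ->]].
split; first by rewrite mdegD d1 d2.
by move=> j jt; rewrite mnmDE H1 ?H2.
Qed.

Lemma lowpart_mlead t e p m : leads p m -> lowpart t e p -> mdeg m = e.
Proof.
move=> [Ep cp] Hp; have p0 : p != 0.
  by apply/eqP=> p0; move: cp; rewrite p0 mcoeff0 => /eqP; rewrite eq_sym oner_eq0.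
by have [] := Hp _ (mlead_supp p0); rewrite Ep.
Qed.

(** Lexicographically, a monomial that involves a variable of index below t is above
    all monomials of the same degree that do not. *)
Lemma leads_add p r m t e (i : 'I_N) : leads p m -> mdeg m = e ->
  (i < t)%N -> (0 < m i)%N -> lowpart t e r -> leads (p + r) m.
Proof.
move=> [Ep cp] dm it mi Hr.
have ltr m' : m' \in msupp r -> (m' < m)%O.
  move=> /Hr[dm' Hm']; apply/ltmcP; first by rewrite dm dm'.
  case: (arg_minnP (fun j : 'I_N => j : nat) (P := fun j => 0 < m j)%N mi) => j mj jmin.
  have jt : (j < t)%N by apply: leq_ltn_trans it; apply: jmin.
  exists j => [l lj|]; last by rewrite Hm'.
  rewrite Hm'; last exact: ltn_trans jt.
  by apply/esym/eqP; rewrite -leqn0 leqNgt; apply: contraL lj => /jmin; rewrite -leqNgt.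
have ltmr : (mlead r < m)%O.
  have [->|r0] := eqVneq r 0; last exact/ltr/mlead_supp.
  rewrite mlead0; apply: lt_mdeg_ltmc; rewrite mdeg0 mdegE (bigD1 i) //=.
  by rewrite addn_gt0 mi.
split; first by rewrite mleadDl Ep.
by rewrite mcoeffD cp mcoeff_gt_mlead // addr0.
Qed.

End Leading.

Section SymplecticRows.
Variables (R : comNzRingType) (M n : nat).
Implicit Types (a b l : seq 'I_n) (T U : seq (seq 'I_n)) (i j x y : 'I_n).

(** The variables of a matrix with M rows and n columns, ordered row by row.
    For c >= M this is the trivial monomial, which keeps the definition total. *)
Definition xmon c i : 'X_{1..M * n} :=
  [multinom ((t == c * n + i :> nat)%N : nat) | t < M * n].

Lemma xmonE c i (d : 'I_M) j (t : 'I_(M * n)) :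
  t = (d * n + j)%N :> nat -> xmon c i t = ((d == c :> nat) && (j == i)) :> nat.
Proof.
move=> Et; rewrite mnmE Et; congr nat_of_bool.
apply/eqP/andP => [E|[/eqP-> /eqP->]//].
have n0 : (0 < n)%N by apply: leq_ltn_trans (ltn_ord i).
have := congr1 (fun q => q %/ n)%N E; have := congr1 (fun q => q %% n)%N E.
rewrite !divnMDl // !modnMDl !(divn_small (ltn_ord _)) !(modn_small (ltn_ord _)).
by rewrite !addn0 => ji ->; rewrite eqxx; split=> //; apply/eqP/val_inj.
Qed.

Lemma xidx_subproof (d : 'I_M) j : (d * n + j < M * n)%N.
Proof.
apply: (@leq_trans (d.+1 * n)); last by rewrite leq_mul2r ltn_ord orbT.
by rewrite mulSn addnC ltn_add2r.
Qed.

Definition xidx (d : 'I_M) j : 'I_(M * n) := Ordinal (xidx_subproof d j).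

Lemma xmon_U (d : 'I_M) j : xmon d j = U_(xidx d j)%MM.
Proof. by apply/mnmP => t; rewrite mnmE mnm1E eq_sym. Qed.

Definition xvar c i : {mpoly R[M * n]} := 'X_[xmon c i].

(** The symplectic form for which the rows c, c + 1 are paired, then c + 2, c + 3, and so
    on. With adjacent rows paired, the leading monomial of a Pfaffian will
    list its indices column by column. *)
Fixpoint rowform d c x y : {mpoly R[M * n]} :=
  if d is d'.+1 then
    xvar c x * xvar c.+1 y - xvar c.+1 x * xvar c y + rowform d' c.+2 x y
  else 0.

Fixpoint rowmon c l : 'X_{1..M * n} :=
  if l is x :: l' then (xmon c x + rowmon c.+1 l')%MM else 0%MM.

Lemma lowpart_xvar t c i :
  (t <= c * n + i)%N -> (c < M)%N -> lowpart t 1 (xvar c i).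
Proof.
move=> tc cM m; rewrite msuppX inE => /eqP->.
rewrite -[c]/(val (Ordinal cM)) xmon_U; split; first by rewrite mdeg1.
move=> j jt; rewrite mnm1E; apply/eqP; rewrite eqb0; apply/eqP => E.
by move: jt; rewrite -E /= ltnNge tc.
Qed.

Lemma lowpart_lwedge (u : 'I_n -> {mpoly R[M * n]}) F l t e :
    {in l, forall i, lowpart t 1 (u i)} ->
    (forall s, {subset s <= l} -> lowpart t e (F s)) ->
  lowpart t e.+1 (lwedge u F l).
Proof.
move=> Hu HF; apply: (lwedge_closed (J := lowpart t e.+1)) => [|p q|x s xs].
- exact: lowpart0.
- exact: lowpartB.
rewrite -add1n; apply: lowpartM; first by apply: Hu; rewrite -(perm_mem xs) mem_head.
by apply: HF => y ys; rewrite -(perm_mem xs) inE ys orbT.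
Qed.

Lemma lowpart_rowform t d c x y : (t <= c * n)%N -> (c + d.*2 <= M)%N ->
  lowpart t 2 (rowform d c x y).
Proof.
elim: d c => [|d IH] c tc cM; first exact: lowpart0.
rewrite /= -[X in lowpart _ _ (_ + X)]opprK.
have H : lowpart t 2 (rowform d c.+2 x y) by apply: IH; rewrite ?mulSn; lia.
apply: lowpartB; last by rewrite -sub0r; apply: lowpartB => //; apply: lowpart0.
by apply: lowpartB; apply: (@lowpartM _ _ t 1 1); apply: lowpart_xvar; rewrite ?mulSn; lia.
Qed.

Lemma lowpart_dpow t d c q l : (t <= c * n)%N -> (c + d.*2 <= M)%N ->
  lowpart t q.*2 (dpow (rowform d c) q l).
Proof.
move=> tc cM; elim: q l => [|q IH] l.
  rewrite /dpow; case: nilp; last exact: lowpart0.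
  by move=> m; rewrite msupp1 inE => /eqP->; rewrite mdeg0; split=> // j _; rewrite mnm0E.
have L0 x y : lowpart t 2 (rowform d c x y) by exact: lowpart_rowform.
case: l => [|x l]; first exact: lowpart0.
rewrite dpow_cons; apply: (lwedge_closed (J := lowpart t q.+1.*2)).
- exact: lowpart0.
- exact: lowpartB.
by move=> y s _; apply: (@lowpartM _ _ t 2 q.*2).
Qed.

Lemma dpow_rowform_vanish d c q l : (d < q)%N -> dpow (rowform d c) q l = 0.
Proof.
elim: d c q l => [|d IH] c [|q] l // dq.
  case: l => [|x l] //; rewrite dpow_cons.
  have -> : rowform 0 c x = (fun y => 0 * (fun=> 0 : {mpoly R[M * n]}) y).
    by apply: funext => y; rewrite mul0r.
  by rewrite lwedge_scalel mul0r.
have zE x y : rowform d.+1 c x y = xvar c x * xvar c.+1 y - xvar c.+1 x * xvar c y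
   + rowform d c.+2 x y by [].
rewrite (dpow_rank2 (u := xvar c) (v := xvar c.+1) _ _ zE) IH ?(ltnW dq) // add0r.
have -> : dpow (rowform d c.+2) q = fun=> 0 by apply: funext => s; apply: IH.
by rewrite (_ : lwedge _ (fun=> 0) = fun=> 0) ?lwedge0 //;
  apply: funext => s; rewrite lwedge0.
Qed.

(** By [dpow_rank2] the Pfaffian is the sum of x_(c, i) x_(c + 1, j) times a
    Pfaffian in the remaining rows, over pairs of its indices, and of terms without the rows c and
    c + 1. The largest contribution takes the first two indices. *)
Lemma dpow_rowform_leads d c q l : (c + d.*2 <= M)%N -> (q <= d)%N ->
  size l = q.*2 -> incr l -> leads (dpow (rowform d c) q l) (rowmon c l).
Proof.
elim: d c q l => [|d IH] c [|q] l //.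
- by move=> _ _ /size0nil-> _; apply: leads1.
- by move=> _ _ /size0nil-> _; apply: leads1.
move=> cM qd; case: l => [|x [|y l]] // [sl] incl.
have zE x' y' : rowform d.+1 c x' y' =
   xvar c x' * xvar c.+1 y' - xvar c.+1 x' * xvar c y' + rowform d c.+2 x' y' by [].
rewrite (dpow_rank2 (u := xvar c) (v := xvar c.+1) _ _ zE); set G := dpow (rowform d c.+2).
have GE : lwedge (xvar c) (lwedge (xvar c.+1) (G q)) (x :: y :: l) =
  xvar c x * (xvar c.+1 y * G q l - lwedge (xvar c.+1) (fun s => G q (y :: s)) l)
  - lwedge (xvar c) (fun s => lwedge (xvar c.+1) (G q) (x :: s)) (y :: l) by [].
have cM2 : (c.+2 + d.*2 <= M)%N by lia.
have [xy /allP xl /allP yl {}incl] : [/\ (x < y)%N, all (fun j : 'I_n => x < j)%N l,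
    all (fun j : 'I_n => y < j)%N l & pairwise (fun i j : 'I_n => i < j)%N l].
  by move: incl; rewrite incr_pairwise /= -andbA => /and4P[].
have incl' : incr l by rewrite incr_pairwise.
have lowG t q' l' : (t <= c.+2 * n)%N -> lowpart t q'.*2 (G q' l').
  by move=> tc; apply: lowpart_dpow.
have low1 t i : (t <= c.+1 * n + i)%N -> lowpart t 1 (xvar c.+1 i).
  by move=> ti; apply: lowpart_xvar => //; lia.
have lead1 : leads (xvar c.+1 y * G q l) (xmon c.+1 y + rowmon c.+2 l)%MM.
  by apply: leadsM; [exact: leadsX | exact: IH].
have deg1 : mdeg (xmon c.+1 y + rowmon c.+2 l) = q.*2.+1.
  apply: (lowpart_mlead (t := c.+1 * n) lead1).
  by apply: (@lowpartM _ _ _ 1 q.*2); [apply: low1; rewrite leq_addr | apply: lowG; rewrite leq_mul2r leqnSn orbT].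
have cM1 : (c.+1 < M)%N by lia.
have lead2 : leads (xvar c.+1 y * G q l
    - lwedge (xvar c.+1) (fun s => G q (y :: s)) l) (xmon c.+1 y + rowmon c.+2 l)%MM.
  apply: (leads_add (t := (c.+1 * n + y).+1) (i := xidx (Ordinal cM1) y) lead1 deg1) => //.
    by rewrite mnmDE (@xmonE _ _ (Ordinal cM1) y) //= !eqxx.
  rewrite -sub0r; apply: lowpartB; first exact: lowpart0.
  apply: lowpart_lwedge => [j jl|s _].
    by apply: low1; rewrite -addnS leq_add2l; apply: yl.
  by apply: lowG; rewrite mulSn addnC -addSn leq_add2r.
have lead3 := leadsM (leadsX _ (xmon c x)) lead2.
have cM0 : (c < M)%N by lia.
have deg3 : mdeg (xmon c x + (xmon c.+1 y + rowmon c.+2 l))%MM = q.+1.*2.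
  by rewrite mdegD deg1 -[c]/(val (Ordinal cM0)) xmon_U mdeg1.
rewrite GE addrCA.
apply: (leads_add (t := (c * n + x).+1) (i := xidx (Ordinal cM0) x) lead3 deg3) => //.
  by rewrite mnmDE (@xmonE _ _ (Ordinal cM0) x) //= !eqxx.
have cn : (c * n + x < c.+1 * n)%N by rewrite mulSn addnC ltn_add2r.
apply: lowpartB; first by apply: lowG; rewrite mulSn; lia.
apply: lowpart_lwedge => [j jl|s _].
  apply: lowpart_xvar => //; rewrite ltn_add2l.
  by move: jl; rewrite inE => /orP[/eqP->|/xl].
rewrite lwedge_cons.
apply: lowpartB; first apply: (@lowpartM _ _ _ 1 q.*2).
- by apply: low1; apply: leq_trans (leq_addr _ _).
- by apply: lowG; rewrite mulSn; lia.
apply: lowpart_lwedge => [j jl|s' _].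
  by apply: low1; apply: leq_trans (leq_addr _ _).
by apply: lowG; rewrite mulSn; lia.
Qed.

Lemma rowmonE c l (d : 'I_M) j : (c + size l <= M)%N ->
  rowmon c l (xidx d j) =
    ((c <= d)%N && (onth l (d - c) == Some j)) :> nat.
Proof.
elim: l c => [|x l IH] c cM /=; first by rewrite mnm0E onth0n andbF.
rewrite mnmDE (@xmonE _ _ d j) // IH; last by rewrite addSnnS.
have [->|dc] := eqVneq (d : nat) c.
  by rewrite leqnn ltnn subnn /= eq_sym addn0.
rewrite /= add0n ltn_neqAle (eq_sym c) dc /=; case: leqP => //= cd.
by rewrite (_ : (d - c = (d - c.+1).+1)%N) //; lia.
Qed.

(** Makes the comparison usable one column at a time, the condition on sizes included. *)
Lemma row_leP a b : reflect
  (forall q y, onth b q = Some y -> exists2 x, onth a q = Some x & (x <= y)%N)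
  (row_le a b).
Proof.
elim: a b => [|x a IH] [|y b] /=; try by constructor => // q y'; rewrite onth0n.
  by constructor => /(_ 0%N y (erefl _))[x]; rewrite onth0n.
apply: (iffP andP) => [[xy /IH ab] [|q] y' //= by'|H]; first 2 last.
- split; first by have [x' [->]] := H 0%N _ (erefl _).
  by apply/IH => q y' /(H q.+1).
- by case: by' => <-; exists x.
exact: ab.
Qed.

Lemma row_le_trans : transitive (@row_le n).
Proof.
move=> b a c /row_leP ab /row_leP bc; apply/row_leP => q y /bc[x /ab[w Ew wx] xy].
by exists w => //; apply: leq_trans xy.
Qed.

Lemma row_le_anti a b : row_le a b -> row_le b a -> a = b.
Proof.
elim: a b => [|x a IH] [|y b] //= /andP[xy ab] /andP[yx ba].
by rewrite (IH b) //; congr cons; apply/val_inj/anti_leq; rewrite xy.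
Qed.

Definition tabmon T : 'X_{1..M * n} := (\sum_(a <- T) rowmon 0 a)%MM.

Definition narrow T := all (fun a => size a <= M)%N T.

Lemma tabmon_gt0 T (d : 'I_M) j : narrow T ->
  (0 < tabmon T (xidx d j))%N = has (fun a => onth a d == Some j) T.
Proof.
rewrite /tabmon; elim: T => [|a T IH]; first by rewrite big_nil mnm0E.
move=> /= /andP[aM TM]; rewrite big_cons mnmDE addn_gt0 IH // rowmonE ?add0n //.
by rewrite subn0 lt0b.
Qed.

Lemma std_cons a T : std (a :: T) -> std T /\ {in a :: T, forall b, row_le a b}.
Proof.
case/andP => /= /andP[_ pT] pa; split; first by rewrite /std pT (path_sorted pa).
move=> b; rewrite inE => /orP[/eqP->|].
  by apply/row_leP => q y Ey; exists y.
by move: b; apply/allP; apply: order_path_min pa; apply: row_le_trans.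
Qed.

(** The first row of a standard tableau is read off from its monomial: its
    entry in column d is the least i such that the variable (d, i) occurs. *)
Lemma tabmon_inj T U : std T -> std U -> narrow T -> narrow U ->
  tabmon T = tabmon U -> T = U.
Proof.
elim: T U => [|a T IH] [|b U] // stdT stdU nT nU E.
- have [_ Hb] := std_cons stdU; case/andP: stdU => /= /andP[/and3P[_ _ nb] _] _.
  case: b nb {Hb} nU E => // x b _ nU E.
  have M0 : (0 < M)%N by case/andP: nU => /= /(leq_trans (ltn0Sn _)).
  have := @tabmon_gt0 [::] (Ordinal M0) x isT.
  by rewrite E tabmon_gt0 //= eqxx.
- case/andP: stdT => /= /andP[/and3P[_ _ na] _] _.
  case: a na nT E => // x a _ nT E.
  have M0 : (0 < M)%N by case/andP: nT => /= /(leq_trans (ltn0Sn _)).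
  have := @tabmon_gt0 [::] (Ordinal M0) x isT.
  by rewrite -E tabmon_gt0 //= eqxx.
have [stdT' Ha] := std_cons stdT; have [stdU' Hb] := std_cons stdU.
have head_le V W c d : narrow (c :: V) -> narrow (d :: W) ->
    tabmon (c :: V) = tabmon (d :: W) -> {in c :: V, forall e, row_le c e} ->
    row_le c d.
  move=> nV nW VW Hc; apply/row_leP => q y dy.
  have qM : (q < M)%N.
    case/andP: nW => dM _; apply: leq_trans dM.
    by rewrite -onthTE dy.
  have := tabmon_gt0 (Ordinal qM) y nW; rewrite -VW tabmon_gt0 //= dy eqxx /=.
  rewrite -/(has _ (c :: V)) => /hasP[e eV /eqP ey].
  by have /row_leP := Hc e eV; apply.
have ab : a = b.
  by apply: row_le_anti; [apply: head_le nT nU E Ha | apply: head_le nU nT (esym E) Hb].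
rewrite -ab in E nU *; congr cons; case/andP: nT => _ nT; case/andP: nU => _ nU.
apply: IH => //; move: E; rewrite /tabmon !big_cons => /eqP.
by rewrite eqm_add2l => /eqP.
Qed.

Variable d : nat.
Hypothesis dM : (d.*2 <= M)%N.

Definition narrow_std T := std T && all (fun a => size a <= d.*2)%N T.

Lemma narrow_stdW T : narrow_std T -> narrow T.
Proof.
by case/andP => _; apply: sub_all => a; move/leq_trans; apply.
Qed.

Lemma tabprod_leads T : narrow_std T ->
  leads (tabprod (rowform d 0) T) (tabmon T).
Proof.
case/andP=> /andP[/allP pT _] /allP dT; rewrite /tabprod /tabmon.
have {pT dT} H a : a \in T -> leads (pf (rowform d 0) a) (rowmon 0 a).
  move=> aT; have /and3P[inca ea _] := pT a aT.
  by apply: dpow_rowform_leads; rewrite ?even_halfK ?half_leqif ?add0n //;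
    rewrite -leq_double even_halfK ?dT.
elim: T H => [|a T IH] H; first by rewrite !big_nil; apply: leads1.
rewrite !big_cons; apply: leadsM; first by apply: H; rewrite mem_head.
by apply: IH => b bT; apply: H; rewrite inE bT orbT.
Qed.

Lemma seq_max (S : eqType) (s : seq S) (f : S -> 'X_{1..M * n}) : s != [::] ->
  exists2 w : S, w \in s & forall v : S, v \in s -> (f v <= f w)%O.
Proof.
elim: s => // x [|y s] IH _.
  by exists x; rewrite ?mem_head // => y; rewrite inE => /eqP->.
have [//|w ws Hw] := IH.
have [le|lt] := leP (f x) (f w).
  exists w; first by rewrite inE ws orbT.
  by move=> v; rewrite inE => /orP[/eqP->//|/Hw].
exists x; first by rewrite mem_head.
move=> v; rewrite inE => /orP[/eqP->//|/Hw vw].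
exact: le_trans vw (ltW lt).
Qed.

(** The coefficient of the largest of the leading monomials is the
    coefficient of a single tableau. *)
Lemma std_free (s : seq (seq (seq 'I_n))) (c : seq (seq 'I_n) -> R) :
    uniq s -> all narrow_std s ->
    \sum_(T <- s) c T *: tabprod (rowform d 0) T = 0 ->
  {in s, forall T, c T = 0}.
Proof.
have [k] := ubnP (size s); elim: k s => // k IH s sk us Hs E.
have [->//|s0] := eqVneq s [::].
have [T Ts Tmax] := seq_max tabmon s0.
have allP' := allP Hs.
have cT : c T = 0.
  have := congr1 (mcoeff (tabmon T)) E; rewrite mcoeff0 raddf_sum /= (bigD1_seq T) //=.
  rewrite mcoeffZ (tabprod_leads (allP' T Ts)).2 mulr1 big1_seq ?addr0 // => U /andP[UT Us].
  have [EU _] := tabprod_leads (allP' U Us).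
  rewrite mcoeffZ mcoeff_gt_mlead ?mulr0 // EU lt_neqAle Tmax // andbT.
  apply: contra UT => /eqP /tabmon_inj UT; apply/eqP/UT;
    by [case/andP: (allP' _ Us) | case/andP: (allP' _ Ts) | apply/narrow_stdW/allP'].
move=> U Us; have [->//|UT] := eqVneq U T.
apply: (IH (rem T s)); rewrite ?rem_uniq ?mem_rem_uniq ?inE ?UT //.
- by rewrite size_rem //; case: (s) sk s0.
- by apply/allP => V /mem_rem /allP'.
by move: E; rewrite (perm_big _ (perm_to_rem Ts)) /= big_cons cT scale0r add0r.
Qed.

End SymplecticRows.

(** * Symplectic Gram-Schmidt up to radical *)

Section RadicalIdeal.
Variable A : comNzRingType.

Definition radical_ideal (L : A -> Prop) :=
  [/\ L 0, forall a b, L a -> L b -> L (a - b), forall a b, L b -> L (a * b) &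
      forall a N, L (a ^+ N) -> L a].

Lemma radical_colon L w : radical_ideal L -> radical_ideal (fun a => L (w * a)).
Proof.
move=> [L0 LB LM LX]; split=> [|a b|a b|a N].
- by rewrite mulr0.
- by rewrite mulrBr; apply: LB.
- by rewrite mulrCA; apply: LM.
move=> Lw; apply: (LX _ N.+1).
have -> : (w * a) ^+ N.+1 = (w ^+ N * a) * (w * a ^+ N).
  by rewrite exprMn !exprS; ring.
exact: LM.
Qed.

End RadicalIdeal.

Section SymplecticSection.
Variables (A : comNzRingType) (I : eqType).

Lemma dpow_kernel (z : I -> I -> A) q i s :
  (forall y, z i y = 0) -> dpow z q (i :: s) = 0.
Proof.
move=> zi; case: q => [|q] //; rewrite dpow_cons.
have -> : z i = (fun y => 0 * (fun=> 0 : A) y).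
  by apply: funext => y; rewrite mul0r zi.
by rewrite lwedge_scalel mul0r.
Qed.

(** Elements s for which s^2 z is a sum of k forms of rank two generate, up to
    radical, the Pfaffian of z. If w = z i j then w z = z_i /\ z_j + z' where
    z' vanishes on i and j, so the solutions for z' on the remaining indices give solutions
    for z; and the Pfaffians of z and z' agree up to powers of w. The Pfaffian of z
    is a combination of the z i j with i its first index. *)
Lemma pf_section k (z : I -> I -> A) (l : seq I) (L : A -> Prop) :
    radical_ideal L -> (forall x, z x x = 0) -> (forall x y, z x y = - z y x) ->
    size l = k.*2 ->
    (forall s (u v : nat -> I -> A),
       {in l &, forall x y, s ^+ 2 * z x y =
          \sum_(a < k) (u a x * v a y - v a x * u a y)} -> L s) ->
  L (dpow z k l).
Proof.
elim: k z l L => [|k IH] z l L HL z_alt z_anti sl HLs.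
  move/size0nil: sl HLs => -> HLs; apply: (HLs 1 (fun _ _ => 0) (fun _ _ => 0)).
  by move=> x.
have [L0 LB LM LX] := HL.
case: l sl HLs => [|i l] // [sl] HLs.
(* the square, so that expanding one factor leaves the Pfaffian in each term *)
apply: (LX _ 2%N); rewrite expr2 {2}dpow_cons -lwedgeZ.
apply: (lwedge_closed L0 LB) => j s js; rewrite mulrA; rewrite mulrC; apply: (LM _).
have [b Eb] : exists b : bool, dpow z k.+1 (i :: l) =
    (-1) ^+ b * dpow z k.+1 (i :: j :: s).
  by apply: alternating_perm; [apply: dpow_alternating | rewrite perm_cons perm_sym].
rewrite Eb mulrCA; apply: (LM _).
have ss : size s = k.*2 by move/perm_size: js => /=; rewrite sl => -[].
set w := z i j.
(* the component of w z that is orthogonal to i and j *)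
pose z' x y := w * z x y - (z i x * z j y - z j x * z i y).
have z'i y : z' i y = 0 by rewrite /z' z_alt (z_anti j i) -/w; ring.
have z'j y : z' j y = 0 by rewrite /z' z_alt -/w; ring.
have z'_anti x y : z' x y = - z' y x by rewrite /z' (z_anti x y); ring.
have z'_alt x : z' x x = 0 by rewrite /z' z_alt; ring.
have step : w ^+ k.+1 * dpow z k.+1 (i :: j :: s) = w ^+ 2 * dpow z' k s.
  rewrite -dpow_scale (@dpow_rank2 _ _ _ z' (z i) (z j)); last first.
    by move=> x y; rewrite /z'; ring.
  rewrite dpow_kernel // add0r lwedge_cons z_alt.
  have dpow_z' q t (h : I) : (forall y, z' h y = 0) ->
      lwedge (z i) (fun s => dpow z' q (h :: s)) t = 0 /\
      lwedge (z j) (fun s => dpow z' q (h :: s)) t = 0.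
    move=> z'h; have -> : (fun s => dpow z' q (h :: s)) = fun=> 0.
      by apply: funext => t'; rewrite dpow_kernel.
    by rewrite !lwedge0.
  have E t : lwedge (z j) (dpow z' k) (i :: t) = - w * dpow z' k t.
    by rewrite lwedge_cons (dpow_z' _ _ i z'i).2 subr0 (z_anti j i).
  rewrite (_ : (fun s => lwedge (z j) (dpow z' k) (i :: s)) =
      fun t => - w * dpow z' k t); last exact: funext.
  rewrite mul0r sub0r lwedgeZ lwedge_cons (dpow_z' _ _ j z'j).1.
  by rewrite -/w; ring.
have LwL : L (w * dpow z' k s).
  apply: (IH z' s (fun a => L (w * a))) => // [|a u v Ha].
    exact: radical_colon.
  pose off (f : I -> A) y := if (y == i) || (y == j) then 0 else f y.
  have -> : w * a = a * w by rewrite mulrC.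
  apply: (HLs _
      (fun c => if c is c'.+1 then off (fun y => w * u c' y)
                else (fun y => a ^+ 2 * w * z i y))
      (fun c => if c is c'.+1 then off (v c') else z j)) => x y xl yl.
  rewrite big_ord_recl /=.
  have -> : (a * w) ^+ 2 * z x y = a ^+ 2 * w * z i x * z j y
      - z j x * (a ^+ 2 * w * z i y) + w * (a ^+ 2 * z' x y).
    by rewrite /z'; ring.
  congr (_ + _).
  have in_s t : t \in i :: l -> ~~ ((t == i) || (t == j)) -> t \in s.
    rewrite inE -(perm_mem js) inE negb_or => /orP[->//|/orP[->|//]].
    by rewrite andbF.
  have z'0 t t' : (t == i) || (t == j) -> z' t t' = 0.
    by case/orP => /eqP->.
  have [xij|xij] := boolP ((x == i) || (x == j)).
    rewrite z'0 // mulr0 mulr0 big1 // => c _.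
    by rewrite /bump /= /off xij !(mul0r, mulr0) subrr.
  have [yij|yij] := boolP ((y == i) || (y == j)).
    rewrite z'_anti z'0 // oppr0 !mulr0 big1 // => c _.
    by rewrite /bump /= /off yij !(mul0r, mulr0) subrr.
  rewrite (Ha _ _ (in_s x xl xij) (in_s y yl yij)) mulr_sumr.
  apply: eq_bigr => c _.
  by rewrite /bump /= /off (negPf xij) (negPf yij); ring.
apply: (LX _ k.+1).
have -> : (w * dpow z k.+1 (i :: j :: s)) ^+ k.+1 =
    dpow z k.+1 (i :: j :: s) ^+ k * w * (w * dpow z' k s).
  rewrite exprMn [X in _ * X]exprS mulrA step; ring.
exact: (LM _).
Qed.

End SymplecticSection.

Section Evaluation.
Variables (R A B : comNzRingType) (N : nat).

Lemma mmap_comp (f : {rmorphism A -> B}) (g : R -> A) (h : 'I_N -> A) p :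
  f (mmap g h p) = mmap (f \o g) (f \o h) p.
Proof.
rewrite /mmap rmorph_sum /=; apply: eq_bigr => m _.
by rewrite rmorphM rmorph_prod; congr (_ * _); apply: eq_bigr => i _; rewrite rmorphXn.
Qed.

Lemma mmap_id (p : {mpoly R[N]}) : mmap (@mpolyC N R) (fun i => 'X_i) p = p.
Proof.
rewrite [RHS]mpolyE /mmap; apply: eq_bigr => m _.
by rewrite mul_mpolyC [in RHS]mpolyXE_id.
Qed.

Lemma mpoly_ring_ind (D : {mpoly R[N]} -> Prop) :
    (forall c, D c%:MP) -> (forall i, D 'X_i) ->
    (forall p q, D p -> D q -> D (p + q)) ->
    (forall p q, D p -> D q -> D (p * q)) ->
  forall p, D p.
Proof.
move=> DC DX DD DM p; rewrite -[p]mmap_id /mmap.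
apply: (big_ind D) => [||m _]; [by rewrite -mpolyC0 | exact: DD | apply: (DM _ _) => //].
rewrite /mmap1; apply: (big_ind D) => [||i _]; [by rewrite -mpolyC1 | by move=> ? ? ? ?; apply: (DM _ _) |].
elim: (m i) => [|j IH]; first by rewrite expr0 -mpolyC1.
by rewrite exprS; apply: DM.
Qed.

End Evaluation.

Section SymplecticForm.
Variables (A : comNzRingType) (k : nat).
Local Notation J := (Jtilde A k).

Lemma antidiag_sq : antidiag A k *m antidiag A k = 1%:M.
Proof.
apply/matrixP=> i j; rewrite !mxE (bigD1 (rev_ord i)) //= !mxE eqxx mul1r rev_ordK.
rewrite big1 ?addr0 ?[j == i]eq_sym // => l /negPf li.
by rewrite !mxE li mul0r.
Qed.

Lemma tr_antidiag : (antidiag A k)^T = antidiag A k.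
Proof.
apply/matrixP=> i j; rewrite !mxE; congr (_%:R); congr nat_of_bool.
by apply/eqP/eqP => ->; rewrite rev_ordK.
Qed.

Lemma tr_Jtilde : J^T = - J.
Proof.
by rewrite /Jtilde tr_block_mx !trmx0 linearN /= tr_antidiag opp_block_mx !oppr0 opprK.
Qed.

Lemma Jtilde_sq : J *m J = (- 1)%:M.
Proof.
rewrite /Jtilde mulmx_block !mul0mx !mulmx0 !addr0 !add0r mulmxN mulNmx antidiag_sq.
by rewrite scalar_mx_block raddfN.
Qed.

Lemma Jtilde_form p q (X : 'M[A]_(k + k, p)) (Y : 'M[A]_(k + k, q)) i j :
  (X^T *m J *m Y) i j = \sum_(a < k)
    (X (lshift k a) i * Y (rshift k (rev_ord a)) j
     - X (rshift k (rev_ord a)) i * Y (lshift k a) j).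
Proof.
have antiE r (Z : 'M[A]_(k, r)) a c : (antidiag A k *m Z) a c = Z (rev_ord a) c.
  rewrite mxE (bigD1 (rev_ord a)) //= mxE eqxx mul1r big1 ?addr0 // => b /negPf ba.
  by rewrite mxE ba mul0r.
rewrite -{1}[X]vsubmxK -{1}[Y]vsubmxK tr_col_mx -mulmxA mul_block_col mul_row_col.
rewrite !mul0mx add0r addr0 mulNmx mulmxN.
rewrite mxE [in X in _ + X]mxE !mxE sumrB; congr (_ + _).
  by apply: eq_bigr => a _; rewrite antiE !mxE.
congr (- _); rewrite (reindex_inj rev_ord_inj) /=.
by apply: eq_bigr => a _; rewrite antiE !mxE rev_ordK.
Qed.

End SymplecticForm.

Lemma map_Jtilde (A B : comNzRingType) (f : {rmorphism A -> B}) k :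
  map_mx f (Jtilde A k) = Jtilde B k.
Proof.
have fa : map_mx f (antidiag A k) = antidiag B k.
  by apply/matrixP=> i j; rewrite !mxE rmorph_nat.
by rewrite /Jtilde map_block_mx !map_mx0 map_mxN fa.
Qed.

(** A one-sided inverse up to a regular scalar is two-sided: cancel det B, which
    divides a power of p. *)
Lemma mulmx_scalarC (A : comNzRingType) r (B C : 'M[A]_r) p :
  GRing.lreg p -> B *m C = p%:M -> C *m B = p%:M.
Proof.
move=> p_reg BC; pose D := C *m B - p%:M.
have BD : B *m D = 0.
  by rewrite mulmxBr mulmxA BC mul_scalar_mx mul_mx_scalar subrr.
have detD : \det B *: D = 0.
  by rewrite -mul_scalar_mx -mul_adj_mx -mulmxA BD mulmx0.
have pD : p ^+ r *: D = 0.
  by rewrite -det_scalar -BC det_mulmx mulrC -scalerA detD scaler0.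
have pr_reg : GRing.lreg (p ^+ r) by apply: lregX.
apply/eqP; rewrite -subr_eq0; apply/eqP/matrixP=> i j; rewrite [RHS]mxE.
have := congr1 (fun E : 'M_r => E i j) pD; rewrite !mxE => Dij.
by apply: pr_reg; rewrite Dij mulr0.
Qed.

(** Up to the scalar s p, the matrix g is a symplectic matrix: Xe and H are two
    frames for the same alternating form up to s^2, and g is the change of
    frame. *)
Lemma twisted_symplectic (A : comNzRingType) k (J := Jtilde A k)
    (Xe V H : 'M[A]_(k + k)) s p :
    H^T *m J *m H = s ^+ 2 *: (Xe^T *m J *m Xe) ->
    Xe^T *m J *m Xe *m V = p%:M -> GRing.lreg p ->
  let g := H *m V *m Xe^T *m J in g^T *m J *m g = (s * p) ^+ 2 *: J.
Proof.
move=> HJ XV p_reg g.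
have VX : Xe *m V *m Xe^T *m J = p%:M.
  by rewrite -mulmxA; apply: mulmx_scalarC => //; rewrite mulmxA.
have JN : J *m (- J) = 1%:M by rewrite mulmxN Jtilde_sq raddfN opprK.
have XVX : Xe *m V *m Xe^T = - (p *: J).
  by rewrite -[LHS]mulmx1 -JN mulmxA VX mul_scalar_mx scalerN.
have trX : Xe *m V^T *m Xe^T = p *: J.
  have -> : Xe *m V^T *m Xe^T = (Xe *m V *m Xe^T)^T.
    by rewrite !trmx_mul trmxK mulmxA.
  rewrite XVX linearN /= linearZ /= tr_Jtilde.
  by rewrite scalerN opprK.
have -> : g^T *m J *m g = J^T *m Xe *m V^T *m (H^T *m J *m H) *m V *m Xe^T *m J.
  by rewrite /g !trmx_mul trmxK !mulmxA.
have -> : J^T *m Xe *m V^T *m (H^T *m J *m H) *m V *m Xe^T *m J =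
    s ^+ 2 *: (J^T *m (Xe *m V^T *m (Xe^T *m J *m Xe *m V) *m Xe^T) *m J).
  by rewrite HJ -!scalemxAr -!scalemxAl !mulmxA.
rewrite XV mul_mx_scalar -scalemxAl trX tr_Jtilde -!scalemxAr -!scalemxAl.
by rewrite mulNmx Jtilde_sq raddfN /= opprK mul1mx !scalerA exprMn -mulrA.
Qed.

(** Formally f is the value of F where d X^2 = 1. Comparing
    coefficients avoids localizing at d, which may be a zero divisor: the even
    coefficients of Q agree with the d^j f modulo S, and they vanish
    eventually. *)
Lemma geometric_denominator (A : comNzRingType) (S : A -> Prop) (F Q : {poly A}) f d :
    (forall a b, S a -> S b -> S (a + b)) -> (forall a, S a -> S (d * a)) ->
    (forall i, S F`_i) -> F - f%:P = (d *: 'X^2 - 1) * Q ->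
  exists N, S (d ^+ N * f).
Proof.
move=> SD Sd SF FQ; exists (size Q).
have coefQ i : F`_i - (if i == 0%N then f else 0) =
    d * (if (i < 2)%N then 0 else Q`_(i - 2)) - Q`_i.
  have := congr1 (fun p : {poly A} => p`_i) FQ.
  by rewrite coefB coefC mulrBl mul1r coefB -scalerAl coefZ coefXnM.
have H j : S (d ^+ j * f - Q`_(j.*2)).
  elim: j => [|j IH].
    have := coefQ 0%N; rewrite /= mulr0 sub0r => E.
    have -> : d ^+ 0 * f - Q`_0 = F`_0 by rewrite -E expr0; ring.
    exact: SF.
  have := coefQ j.+1.*2; rewrite doubleS subr0 /= subn2 /= => E.
  have -> : d ^+ j.+1 * f - Q`_(j.*2.+2) = d * (d ^+ j * f - Q`_(j.*2)) + F`_(j.*2.+2).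
    by rewrite E exprS; ring.
  by apply: (SD _ _) => //; apply: Sd.
have := H (size Q); rewrite nth_default ?subr0 //.
by rewrite -addnn leq_addr.
Qed.

Lemma denominatorB (A : comNzRingType) (S : A -> Prop) a b f N N' :
    S 0 -> (forall c d, S c -> S d -> S (c - d)) ->
    (forall c, S c -> S (a * c)) -> (forall c, S c -> S (b * c)) ->
    S (a ^+ N * f) -> S (b ^+ N' * f) ->
  S ((a - b) ^+ (N + N') * f).
Proof.
move=> S0 SB Sa Sb Saf Sbf.
have SN c : S c -> S (- c) by move=> Sc; rewrite -sub0r; apply: (SB _ _).
have SD c d : S c -> S d -> S (c + d).
  by move=> Sc Sd; rewrite -[d]opprK; apply: (SB _ _) => //; apply: SN.
have SX i j c : S c -> S (a ^+ i * (b ^+ j * c)).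
  move=> Sc; elim: i => [|i IH]; last by rewrite exprS -mulrA; apply: (Sa _).
  rewrite mul1r; elim: j => [|j IH]; first by rewrite mul1r.
  by rewrite exprS -mulrA; apply: (Sb _).
rewrite exprBn mulr_suml; apply: (big_ind S) => // i _.
rewrite mulrnAl; elim: ('C(_, _)) => [|c IH] //; rewrite mulrS; apply: (SD _ _) => //.
rewrite -signr_odd; have {IH} : S (a ^+ (N + N' - i) * b ^+ i * f).
  have [iN|Ni] := leqP i N'.
    have -> : a ^+ (N + N' - i) * b ^+ i * f =
        a ^+ (N' - i) * (b ^+ i * (a ^+ N * f)).
      by rewrite -addnBA // exprD; ring.
    exact: SX.
  have -> : a ^+ (N + N' - i) * b ^+ i * f =
      a ^+ (N + N' - i) * (b ^+ (i - N') * (b ^+ N' * f)).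
    by rewrite [b ^+ (i - N') * _]mulrA -exprD subnK ?mulrA // ltnW.
  exact: SX.
by case: odd => H; rewrite ?expr1 ?expr0 -!mulrA ?mulN1r ?mul1r !mulrA //; apply: SN.
Qed.

(** * Invariants become functions of the Gram matrix after inverting a Pfaffian *)

Section IdealCongruence.
Variables (A : comNzRingType) (K : finType) (g : K -> A).
Implicit Types a b c d : A.

Lemma gen_ideal_congrD a b c d : a - b \in gen_ideal g -> c - d \in gen_ideal g ->
  (a + c) - (b + d) \in gen_ideal g.
Proof. by move=> ab cd; rewrite opprD addrACA rpredD. Qed.

Lemma gen_ideal_congrM a b c d : a - b \in gen_ideal g -> c - d \in gen_ideal g ->
  a * c - b * d \in gen_ideal g.
Proof.
move=> ab cd; have -> : a * c - b * d = a * (c - d) + d * (a - b) by ring.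
by rewrite rpredD ?gen_idealMr.
Qed.

End IdealCongruence.

Section Saturation.
Variables (R : comNzRingType) (k n : nat).
Local Notation m := (k + k)%N.
Local Notation P := (polyZ R n).
Local Notation M := (coordM R k n).
Local Notation X := (genericX R k n).
Local Notation Z := (genericZ R n).

(** A name for the comorphism at fixed types, to carry its structure of ring morphism. *)
Definition piM (p : P) : M := pi_comorphism k p.
HB.instance Definition _ := GRing.RMorphism.copy piM (@pi_comorphism R k n).

Definition zfun (i j : 'I_n) : P := Z i j.
Definition gram (i j : 'I_n) : M := (X^T *m Jtilde M k *m X) i j.

Lemma zfun_alt i : zfun i i = 0.
Proof.
by rewrite /zfun mxE; case: insubP => [p /= + _|_ //]; rewrite ltnn.
Qed.

Lemma zfun_anti i j : zfun i j = - zfun j i.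
Proof.
rewrite /zfun !mxE; case: insubP => [p /= ij Ep|ij].
  case: insubP => [q /= ji _|_]; first by move: (ltn_trans ij ji); rewrite ltnn.
  by rewrite opprK.
by case: insubP => [q _ _|_]; rewrite ?oppr0.
Qed.

Lemma gram_alt i : gram i i = 0.
Proof.
rewrite /gram Jtilde_form; apply: big1 => a _.
by rewrite mulrC subrr.
Qed.

Lemma gram_anti i j : gram i j = - gram j i.
Proof.
rewrite /gram !Jtilde_form -sumrN; apply: eq_bigr => a _; ring.
Qed.

Lemma piM_zfun i j : piM (zfun i j) = gram i j.
Proof.
have piX (p : upper_pair n) :
    piM 'X_(enum_rank p) = gram (val p).1 (val p).2.
  by rewrite /piM /pi_comorphism mmapX mmap1U enum_rankK.
rewrite /zfun mxE; case: insubP => [p ij Ep|ij]; first by rewrite piX Ep.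
case: insubP => [q ji Eq|ji].
  have piN : piM (- 'X_(enum_rank q)) = - piM 'X_(enum_rank q) by apply: rmorphN.
  by rewrite piN piX Eq [RHS]gram_anti.
have piM0 : piM 0 = 0 by apply: rmorph0.
have -> : i = j.
  by apply/val_inj/eqP; rewrite /= eqn_leq leqNgt ji leqNgt ij.
by rewrite gram_alt.
Qed.

Lemma piM_X t : piM 'X_t = gram (val (enum_val t)).1 (val (enum_val t)).2.
Proof. by rewrite /piM /pi_comorphism mmapX mmap1U. Qed.

Lemma piM_C c : piM c%:MP = c%:MP.
Proof. by rewrite /piM /pi_comorphism mmapC. Qed.

(** With iota the structure map of an R-algebra B, the value of f at a B-point of M. *)
Definition subst_mx (B : comNzRingType) (iota : {rmorphism R -> B})
  (Y : 'M[B]_(m, n)) (f : M) : B := mmap iota (fun j => mxvec Y 0 j) f.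

Lemma subst_mx_morph (B C : comNzRingType) (g : {rmorphism B -> C}) 
    (iota : {rmorphism R -> B}) (iota' : {rmorphism R -> C}) Y f :
  (forall c, g (iota c) = iota' c) ->
  g (subst_mx iota Y f) = subst_mx iota' (map_mx g Y) f.
Proof.
move=> gi; rewrite /subst_mx mmap_comp; congr (mmap _ _ f); apply: funext => c /=.
  exact: gi.
by rewrite -map_mxvec mxE.
Qed.

(** Scheme-theoretic invariance, specialized: for an arbitrary matrix G over an
    R-algebra, f(G Y) and f(Y) agree modulo the equations that say that G is symplectic. *)
Lemma invariant_subst (B : comNzRingType) (iota : {rmorphism R -> B})
    (G : 'M[B]_m) (Y : 'M[B]_(m, n)) f : f \in @is_invariant R k n ->
  exists c, subst_mx iota (G *m Y) f - subst_mx iota Y f =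
    \sum_ab c ab * (G^T *m Jtilde B k *m G - Jtilde B k) ab.1 ab.2.
Proof.
rewrite -[f \in _]/(_ == _) quot_class_eq => /gen_idealP[c Ec].
pose th : polyGM R k n -> B := mmap iota (fun t => match split t with
  | inl i => mxvec G 0 i | inr j => mxvec Y 0 j end).
have thG : map_mx th (varG R k n) = G.
  apply/matrixP=> a b; rewrite !mxE /th mmapX mmap1U.
  by rewrite -[lshift _ _]/(unsplit (inl _)) unsplitK mxvecE.
have thM : map_mx th (varM R k n) = Y.
  apply/matrixP=> a b; rewrite !mxE /th mmapX mmap1U.
  by rewrite -[rshift _ _]/(unsplit (inr _)) unsplitK mxvecE.
have thC W : th (mmap (@mpolyC _ R) (fun j => mxvec W 0 j) f) =
    subst_mx iota (map_mx th W) f.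
  by apply: (@subst_mx_morph _ _ th (@mpolyC _ R)) => e; rewrite /th /= mmapC.
exists (fun ab => th (c ab)).
rewrite -[X in subst_mx _ (X *m _) _]thG -[in X in _ - X]thM -[X in _ *m X]thM.
rewrite -map_mxM -!thC -rmorphB; apply: etrans (congr1 th Ec) _.
apply: etrans (rmorph_sum th _ _ _) _; apply: eq_bigr => ab _.
apply: etrans (rmorphM th _ _) _; congr (_ * _).
have -> : G^T *m Jtilde B k *m G - Jtilde B k = map_mx th ((varG R k n)^T *m
    Jtilde (polyGM R k n) k *m varG R k n - Jtilde (polyGM R k n) k).
  by rewrite map_mxB !map_mxM -map_trmx thG map_Jtilde.
by rewrite [in RHS]mxE.
Qed.

Lemma subst_mx_generic f : subst_mx (@mpolyC _ R) X f = f.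
Proof.
rewrite -[RHS]mmap_id /subst_mx; congr (mmap _ _ f); apply: funext => j.
by case/mxvec_indexP: j => a i; rewrite mxvecE mxE.
Qed.

(** The two pullbacks of <x_i, x_j> differ by an entry of
    tX (tg J~ g - J~) X. *)
Lemma piM_invariant p : piM p \in @is_invariant R k n.
Proof.
rewrite -[_ \in _]/(_ == _) quot_class_eq.
set E := fun Y : 'M[polyGM R k n]_(m, n) => subst_mx (@mpolyC _ R) Y.
rewrite -[X in X \in _]/(E (varG R k n *m varM R k n) (piM p) - E (varM R k n) (piM p)).
have EB Y : E Y = mmap (@mpolyC _ R) (fun j => mxvec Y 0 j) by [].
have Egram Y i j : E Y (gram i j) = (Y^T *m Jtilde _ k *m Y) i j.
  have EX : map_mx (mmap (@mpolyC _ R) (fun j => mxvec Y 0 j)) X = Y.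
    by apply/matrixP=> a b; rewrite !mxE mmapX mmap1U mxvecE.
  by rewrite EB -[in RHS]EX /gram map_trmx -(map_Jtilde (mmap (@mpolyC _ R)
    (fun j => mxvec Y 0 j))) -!map_mxM [RHS]mxE.
have EC Y c : E Y c%:MP = c%:MP by rewrite EB mmapC.
have ED Y q r : E Y (q + r) = E Y q + E Y r by rewrite EB raddfD.
have EM Y q r : E Y (q * r) = E Y q * E Y r by rewrite EB rmorphM.
elim/mpoly_ring_ind: p => [c|t|p q IHp IHq|p q IHp IHq].
- by rewrite piM_C !EC subrr rpred0.
- rewrite piM_X !Egram trmx_mul !mulmxA.
  set i := _.1; set j := _.2; set Y := varM R k n; set G := varG R k n.
  set J := Jtilde _ k.
  have -> : (Y^T *m G^T *m J *m G *m Y) i j - (Y^T *m J *m Y) i j =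
      (Y^T *m (G^T *m J *m G - J) *m Y) i j.
    by rewrite mulmxBr mulmxBl !mulmxA [RHS]mxE [X in _ = _ + X]mxE.
  rewrite mxE; apply: rpred_sum => b _; rewrite mulrC; apply: gen_idealMr.
  rewrite mxE; apply: rpred_sum => a _; apply: gen_idealMr.
  apply/gen_idealP; exists (fun ab => (ab == (a, b))%:R).
  rewrite (bigD1 (a, b)) //= eqxx mul1r big1 ?addr0 // => ab /negPf->.
  by rewrite mul0r.
- have -> : piM (p + q) = piM p + piM q by apply: rmorphD.
  by rewrite !ED; exact: gen_ideal_congrD IHp IHq.
have -> : piM (p * q) = piM p * piM q by apply: rmorphM.
by rewrite !EM; exact: gen_ideal_congrM IHp IHq.
Qed.

Section Denominator.
Variables (e : 'I_m -> 'I_n) (s p : P) (H V : 'M[P]_m) (f : M).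
Hypotheses (fI : f \in @is_invariant R k n)
  (HJ : H^T *m Jtilde P k *m H = s ^+ 2 *: mxsub e e Z)
  (ZV : mxsub e e Z *m V = p%:M) (p_reg : GRing.lreg (piM p)).

(** The matrix that is symplectic up to the factor s p and takes X to a matrix with entries in
    the image of R[z]. *)
Definition twist : 'M[M]_m :=
  map_mx piM H *m map_mx piM V *m (colsub e X)^T *m Jtilde M k.

Lemma twistE : twist^T *m Jtilde M k *m twist = piM (s * p) ^+ 2 *: Jtilde M k.
Proof.
have ZeE : (colsub e X)^T *m Jtilde M k *m colsub e X = map_mx piM (mxsub e e Z).
  apply/matrixP=> i j; rewrite [RHS]mxE [X in piM X]mxE -/(zfun _ _) piM_zfun /gram.
  by rewrite !Jtilde_form; apply: eq_bigr => a _; rewrite !mxE.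
have -> : piM (s * p) = piM s * piM p by apply: rmorphM.
apply: (twisted_symplectic _ _ p_reg); rewrite ZeE.
  rewrite map_trmx -(map_Jtilde piM) -!map_mxM HJ map_mxZ; congr (_ *: _).
  exact: rmorphXn.
by rewrite -map_mxM ZV map_scalar_mx.
Qed.

Lemma twist_mul : twist *m X = map_mx piM (H *m V *m rowsub e Z).
Proof.
have ZeE : (colsub e X)^T *m Jtilde M k *m X = map_mx piM (rowsub e Z).
  apply/matrixP=> i j; rewrite [RHS]mxE [X in piM X]mxE -/(zfun _ _) piM_zfun /gram.
  by rewrite !Jtilde_form; apply: eq_bigr => a _; rewrite !mxE.
by rewrite 2!map_mxM -ZeE /twist !mulmxA.
Qed.

(** With a variable y in the role of (s p)^-1, the matrix y twist is symplectic
    modulo (s p)^2 y^2 - 1, and f(y twist X) has its coefficients in the image. *)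
Lemma clear_denominator : exists N q, piM (s * p) ^+ N * f = piM q.
Proof.
set d := piM (s * p).
pose iM : R -> {poly M} := polyC \o @mpolyC _ R.
pose iP : R -> {poly P} := polyC \o @mpolyC _ R.
pose Y := H *m V *m rowsub e Z.
pose F := subst_mx iP ('X *: map_mx polyC Y) f.
have [c Ec] := invariant_subst iM ('X *: map_mx polyC twist) (map_mx polyC X) fI.
have EF : subst_mx iM ('X *: map_mx polyC twist *m map_mx polyC X) f = map_poly piM F.
  rewrite (@subst_mx_morph _ _ (map_poly piM) iP iM) => [|a]; last first.
    by rewrite /iP /iM /= map_polyC /= piM_C.
  congr (subst_mx _ _ f); rewrite -scalemxAl -map_mxM twist_mul.
  apply/matrixP=> i j; rewrite !mxE rmorphM /= map_polyX map_polyC; congr (_ * _%:P).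
have EX : subst_mx iM (map_mx polyC X) f = f%:P.
  rewrite -(@subst_mx_morph _ _ polyC (@mpolyC _ R) iM) //.
  by congr _%:P; apply: subst_mx_generic.
pose Q := \sum_ab c ab * Jtilde {poly M} k ab.1 ab.2.
have EQ : map_poly piM F - f%:P = (d ^+ 2 *: 'X^2 - 1) * Q.
  rewrite -EF -EX Ec /Q mulr_sumr; apply: eq_bigr => ab _; rewrite mulrCA; congr (_ * _).
  have -> : ('X *: map_mx polyC twist)^T *m Jtilde {poly M} k *m
      ('X *: map_mx polyC twist) = (d ^+ 2 *: 'X^2) *: Jtilde {poly M} k.
    rewrite [('X *: _)^T]linearZ /= -!scalemxAl -scalemxAr scalerA map_trmx.
    rewrite -(map_Jtilde polyC) -!map_mxM twistE map_mxZ scalerA; congr (_ *: _).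
    by rewrite -expr2 -mul_polyC mulrC.
  by rewrite [LHS]mxE [X in X + _]mxE [X in _ + X]mxE mulrBl mul1r.
have [|||N [q Eq]] := geometric_denominator (S := fun a => exists q, a = piM q) _ _ _ EQ.
- move=> _ _ [a ->] [b ->]; exists (a + b); apply: esym; exact: rmorphD.
- move=> _ [a ->]; exists ((s * p) ^+ 2 * a); apply: esym.
  by apply: etrans (rmorphM _ _ _) _; congr (_ * _); apply: rmorphXn.
- by move=> i; exists F`_i; rewrite coef_map.
by exists (2 * N)%N, q; rewrite exprM.
Qed.

End Denominator.

(** [pf_section] gives p in the radical of the s p for which
    [clear_denominator] applies; the inverse V of the Gram
    matrix up to p is read off from the expansions of the Pfaffian p along its
    rows. *)
Lemma invariant_denominator (e : 'I_m -> 'I_n) f : let l := map e (enum 'I_m) in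
    uniq l -> f \in @is_invariant R k n -> GRing.lreg (dpow gram k l) ->
  exists N q, piM (dpow zfun k l) ^+ N * f = piM q.
Proof.
move=> l ul fI p_reg; set p := dpow zfun k l.
have gramE : gram = fun x y => piM (zfun x y).
  by apply: funext => x; apply: funext => y; rewrite piM_zfun.
have Ep : dpow gram k l = piM p by rewrite gramE -dpow_morph.
have sl : size l = k.*2 by rewrite size_map size_enum_ord addnn.
have [V ZV] : exists V, mxsub e e Z *m V = p%:M.
  (* column a collects the cofactors of the word with the letter e a removed:
     putting e i in front gives p up to sign if i = a, and a repeated letter
     otherwise *)
  have col a : exists v : 'I_m -> P, forall i,
      \sum_b zfun (e i) (e b) * v b = (i == a)%:R * p.
    pose s := rem a (enum 'I_m).
    have sE : perm_eq (a :: s) (enum 'I_m) by rewrite perm_sym perm_to_rem ?mem_enum.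
    have [v Hv] := lwedge_coef e (dpow zfun k.-1) s.
    have k0 : (0 < k)%N by case: (k) (a) => // -[].
    have dE i : \sum_b zfun (e i) (e b) * v b = dpow zfun k (map e (i :: s)).
      rewrite -Hv; have -> // : dpow zfun k = dpow zfun k.-1.+1 by rewrite prednK.
    have [b Eb] := alternating_perm (dpow_alternating zfun_alt zfun_anti k)
      (perm_map e sE).
    exists (fun c => (-1) ^+ b * v c) => i.
    rewrite (eq_bigr (fun c => (-1) ^+ b * (zfun (e i) (e c) * v c))) => [|c _];
      last by rewrite mulrCA.
    rewrite -mulr_sumr dE; have [->|ia] := eqVneq i a.
      by rewrite Eb mulrA -expr2 sqrr_sign.
    rewrite (alternating_dup (dpow_alternating zfun_alt zfun_anti k)) ?mul0r ?mulr0 //.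
    rewrite /= negb_and negbK map_f //.
    by have := perm_mem sE i; rewrite inE (negPf ia) mem_enum.
  have [v Hv] := choice col.
  exists (\matrix_(b, a) v a b); apply/matrixP=> i a; rewrite !mxE -[RHS]mulr_natl -Hv.
  by apply: eq_bigr => b _; rewrite /zfun !mxE.
pose inL c := exists N q, piM c ^+ N * f = piM q.
have pin a N : piM (a ^+ N) = piM a ^+ N by apply: rmorphXn.
have piMM a b : piM (a * b) = piM a * piM b by apply: rmorphM.
have piMB a b : piM (a - b) = piM a - piM b by apply: rmorphB.
have piMD a b : piM (a + b) = piM a + piM b by apply: rmorphD.
have radL : radical_ideal inL.
  split.
  - exists 1%N, 0; have -> : piM 0 = 0 by apply: rmorph0.
    by rewrite mul0r.
  - move=> a b [N [q Eq]] [N' [q' Eq']]; exists (N + N')%N.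
    rewrite piMB; apply: (denominatorB (S := fun c => exists q, c = piM q)).
    + by exists 0; apply: esym; apply: rmorph0.
    + by move=> _ _ [c ->] [d ->]; exists (c - d); rewrite piMB.
    + by move=> _ [c ->]; exists (a * c); rewrite piMM.
    + by move=> _ [c ->]; exists (b * c); rewrite piMM.
    + by exists q.
    by exists q'.
  - move=> a b [N [q Eq]]; exists N, (a ^+ N * q).
    by rewrite (piMM a b) (piMM (a ^+ N) q) pin exprMn -mulrA Eq.
  by move=> a N [N' [q Eq]]; exists (N * N')%N, q; rewrite exprM -pin.
have : inL (p * p).
  apply: (pf_section (radical_colon p radL) zfun_alt zfun_anti sl) => s u v Huv.
  pose H : 'M[P]_m := col_mx (\matrix_(a, b) u a (e b))
    (\matrix_(a, b) v (rev_ord a) (e b)).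
  have HJ : H^T *m Jtilde P k *m H = s ^+ 2 *: mxsub e e Z.
    apply/matrixP=> i j; rewrite Jtilde_form [RHS]mxE [X in _ * X]mxE -/(zfun _ _).
    rewrite Huv ?map_f ?mem_enum //; apply: eq_bigr => a _.
    by rewrite !col_mxEu !col_mxEd !mxE rev_ordK.
  rewrite mulrC; apply: (@clear_denominator e s p H V f fI HJ ZV).
  by rewrite -Ep.
have [_ _ _ LX] := radL.
by rewrite -expr2; apply: LX.
Qed.

End Saturation.

(** * The sum over permutations is the iterated row expansion *)

Section PfaffExpansion.
Variable A : comNzRingType.

(** The inverse removes i and j = s i and renumbers. *)
Lemma lift_perm_bij N (i j : 'I_N.+1) :
  {on [pred s : 'S_N.+1 | s i == j], bijective (lift_perm i j)}.
Proof.
pose lower (s : 'S_N.+1) x := odflt x (unlift (s i) (s (lift i x))).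
have lowerK (s : 'S_N.+1) x : lift (s i) (lower s x) = s (lift i x).
  rewrite /lower; have := neq_lift i x.
  by rewrite -(inj_eq (@perm_inj _ s)) => /unlift_some[] ? ? ->.
have lower_inj (s : 'S_N.+1) : injective (lower s).
  move=> x y xy; apply: (@lift_inj _ i); apply: (@perm_inj _ s).
  by rewrite -!lowerK xy.
exists (fun s => perm (lower_inj s)) => [s _|s /eqP sij].
  by apply/permP=> x; rewrite permE /lower lift_perm_lift lift_perm_id liftK.
apply/permP=> x; case: (unliftP i x) => [y|] ->; rewrite ?lift_perm_id //.
by rewrite lift_perm_lift -sij permE lowerK.
Qed.

Lemma big_lift_perm N (i : 'I_N.+1) (Q : pred 'S_N.+1) (F : 'S_N.+1 -> A) :
  \sum_(s | Q s) F s =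
  \sum_j \sum_(s | Q (lift_perm i j s)) F (lift_perm i j s).
Proof.
rewrite (partition_big (fun s : 'S_N.+1 => s i) predT) //=.
apply: eq_bigr => j _; rewrite (reindex (lift_perm i j)); last first.
  have [g gK Kg] := lift_perm_bij i j.
  by exists g => s; rewrite inE => /andP[_ si]; [apply: gK | apply: Kg]; rewrite inE.
by apply: eq_bigl => s; rewrite lift_perm_id eqxx andbT.
Qed.

Lemma lwedge_enum (I : eqType) N (e : 'I_N.+1 -> I) (w : I -> A) F :
  lwedge w F [seq e i | i <- enum 'I_N.+1] =
  \sum_(j < N.+1) (-1) ^+ j * w (e j) * F [seq e (lift j i) | i <- enum 'I_N].
Proof.
elim: N e F => [|N IH] e F; rewrite enum_ordSl map_cons lwedge_cons -map_comp.
  rewrite big_ord1 expr0 mul1r.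
  have -> : enum 'I_0 = [::] by apply/size0nil/size_enum_ord.
  by rewrite /= subr0.
rewrite IH [RHS]big_ord_recl mul1r -sumrN; congr (_ + _).
apply: eq_bigr => j _ /=; rewrite -mulNr; congr (_ * F _).
  by rewrite /bump exprS; ring.
rewrite [enum 'I_N.+1]enum_ordSl /=; congr (e _ :: _); first exact: val_inj.
rewrite -map_comp; apply: eq_map => i /=; congr e; apply: val_inj => /=.
by rewrite /bump /= !add1n ltnS !addnS.
Qed.

Lemma pfaffian_permP t (s : 'S_t.*2) : reflect
  ((forall i j : 'I_t, (i < j)%N -> (s (pair_fst i) < s (pair_fst j))%N) /\
   (forall i : 'I_t, (s (pair_fst i) < s (pair_snd i))%N))
  (pfaffian_perm s).
Proof.
apply: (iffP andP) => -[H1 H2]; split.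
- by move=> i j; move/forallP/(_ i)/forallP/(_ j)/implyP: H1.
- by move/forallP: H2.
- by apply/forallP=> i; apply/forallP=> j; apply/implyP/H1.
- by apply/forallP.
Qed.

Lemma pair_fst_lift t (i : 'I_t) :
  pair_fst (lift ord0 i) = lift ord0 (lift ord0 (pair_fst i)) :> 'I_t.*2.+2.
Proof. exact: val_inj. Qed.

Lemma pair_snd_lift t (i : 'I_t) :
  pair_snd (lift ord0 i) = lift ord0 (lift ord0 (pair_snd i)) :> 'I_t.*2.+2.
Proof. exact: val_inj. Qed.

Lemma ltn_lift N (h : 'I_N.+1) (i j : 'I_N) : (lift h i < lift h j)%N = (i < j)%N.
Proof. by rewrite !ltnNge leq_bump2. Qed.

(** The value 0 is taken at some pair_fst i or pair_snd i, and s increases from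
    pair_fst 0 to each of these. *)
Lemma pfaffian_perm0 t (s : 'S_t.*2.+2) :
  pfaffian_perm (s : 'S_(t.+1).*2) -> s ord0 = ord0.
Proof.
case/pfaffian_permP => [H1 H2].
pose x := (s^-1)%g ord0; have sx : s x = ord0 by rewrite permKV.
have x2 : (x./2 < t.+1)%N.
  by have := ltn_ord x; rewrite -[t.*2.+2]/(t.+1.*2) ltn_half_double.
pose i := Ordinal x2.
have si : (s (pair_fst i) <= s x)%N.
  have := odd_double_half x; case: (odd x) => /= Ex.
    have -> : x = pair_snd i by apply: val_inj; rewrite /= -[LHS]Ex.
    exact/ltnW/H2.
  by rewrite (_ : pair_fst i = x) //; apply: val_inj; rewrite /= -[RHS]Ex.
have {si} s0 : (s (pair_fst (ord0 : 'I_t.+1)) <= s x)%N.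
  have [i0|i0] := posnP (i : nat); last by apply: leq_trans si; apply/ltnW/H1.
  by rewrite (_ : ord0 = i) //; apply: val_inj.
have f0 : pair_fst (ord0 : 'I_t.+1) = ord0 :> 'I_t.*2.+2 by exact: val_inj.
by move: s0; rewrite f0 sx /= leqn0 => /eqP s0; apply: val_inj.
Qed.

Lemma lift2_perm_pairs t (j : 'I_t.*2.+1) (s : 'S_t.*2)
    (s2 := lift_perm ord0 ord0 (lift_perm ord0 j s) : 'S_(t.+1).*2) :
  [/\ s2 (pair_fst ord0) = ord0 :> 'I_t.*2.+2,
      s2 (pair_snd ord0) = lift ord0 j :> 'I_t.*2.+2,
      forall i : 'I_t, s2 (pair_fst (lift ord0 i)) =
         lift ord0 (lift j (s (pair_fst i))) :> 'I_t.*2.+2 &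
      forall i : 'I_t, s2 (pair_snd (lift ord0 i)) =
         lift ord0 (lift j (s (pair_snd i))) :> 'I_t.*2.+2].
Proof.
have f0 : pair_fst (ord0 : 'I_t.+1) = ord0 :> 'I_t.*2.+2 by exact: val_inj.
have n0 : pair_snd (ord0 : 'I_t.+1) = lift ord0 ord0 :> 'I_t.*2.+2 by exact: val_inj.
split=> [||i|i]; rewrite /s2.
- by rewrite f0 lift_perm_id.
- by rewrite n0 lift_perm_lift lift_perm_id.
- by rewrite pair_fst_lift !lift_perm_lift.
by rewrite pair_snd_lift !lift_perm_lift.
Qed.

(** Removing the first pair (0, j + 1) from a perfect matching is a bijection onto the
    matchings of the remaining points. *)
Lemma pfaffian_perm_lift t (j : 'I_t.*2.+1) (s : 'S_t.*2) :
  pfaffian_perm (lift_perm ord0 ord0 (lift_perm ord0 j s) : 'S_(t.+1).*2) =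
  pfaffian_perm s.
Proof.
have [f0 n0 fl nl] := lift2_perm_pairs j s.
apply/pfaffian_permP/pfaffian_permP => -[H1 H2]; split.
- by move=> i i' ii'; have := H1 (lift ord0 i) (lift ord0 i'); rewrite !fl !ltn_lift; apply.
- by move=> i; have := H2 (lift ord0 i); rewrite fl nl !ltn_lift.
- move=> i i'; case: (unliftP ord0 i) => [i1|] ->; case: (unliftP ord0 i') => [i2|] -> //.
    by rewrite !fl !ltn_lift; apply: H1.
  by rewrite fl f0.
move=> i; case: (unliftP ord0 i) => [i1|] ->; first by rewrite fl nl !ltn_lift.
by rewrite f0 n0.
Qed.

Lemma Pfaff_expand t (B : 'M[A]_((t.+1).*2)) :
  Pfaff B = \sum_(j < t.*2.+1) (-1) ^+ j * (B : 'M[A]_(t.*2.+2)) ord0 (lift ord0 j) *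
    Pfaff (mxsub (fun i => lift ord0 (lift j i) : 'I_t.*2.+2)
                 (fun i => lift ord0 (lift j i) : 'I_t.*2.+2) (B : 'M[A]_(t.*2.+2))).
Proof.
rewrite /Pfaff (@big_lift_perm t.*2.+1 ord0) (bigD1 ord0) //= [X in _ + X]big1 => [|j j0].
  rewrite addr0 (@big_lift_perm t.*2 ord0); apply: eq_bigr => j _.
  rewrite mulr_sumr; apply: eq_big => [s|s _]; first exact: pfaffian_perm_lift.
  have [f0 n0 fl nl] := lift2_perm_pairs j s.
  rewrite !odd_lift_perm /= big_ord_recl f0 n0 signr_addb signr_odd.
  rewrite -!mulrA; congr (_ * _); rewrite mulrCA; congr (_ * (_ * _)).
  by apply: eq_bigr => i _; rewrite fl nl mxE.
apply: big_pred0 => s; apply/negP => /pfaffian_perm0; rewrite lift_perm_id.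
by move/eqP; rewrite (negPf j0).
Qed.

Lemma dpow_map (I K : eqType) (h : K -> I) (z : I -> I -> A) q s :
  dpow (fun x y => z (h x) (h y)) q s = dpow z q (map h s).
Proof.
have lwedge_map (w : I -> A) F l :
    lwedge (fun x => w (h x)) (fun t => F (map h t)) l = lwedge w F (map h l).
  by elim: l F => //= y l IH F; rewrite -IH.
elim: q s => [|q IH] [|x s] //; rewrite map_cons !dpow_cons -lwedge_map.
by congr (lwedge _ _ s); apply: funext.
Qed.

(** Both sides satisfy the expansion along the first row. *)
Lemma Pfaff_dpow t (B : 'M[A]_(t.*2)) :
  Pfaff B = dpow (fun i j => B i j) t (enum 'I_t.*2).
Proof.
elim: t B => [|t IH] B.
  have -> : enum 'I_0.*2 = [::] by apply/size0nil/size_enum_ord.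
  rewrite /Pfaff (big_pred1 (1%g : 'S_(0.*2))) => [|s]; first by rewrite odd_perm1 big_ord0 mulr1.
  have -> : s = 1%g by apply/permP => -[].
  by rewrite /= eqxx; apply/pfaffian_permP; split => -[].
rewrite Pfaff_expand [enum _](enum_ordSl t.*2.+1) dpow_cons lwedge_enum.
apply: eq_bigr => j _; congr (_ * _); rewrite IH.
rewrite -(dpow_map (fun i => lift ord0 (lift j i) : 'I_(t.+1).*2) (fun x y => B x y)).
by congr (dpow _ _ _); apply: funext => i; apply: funext => i'; rewrite mxE.
Qed.

End PfaffExpansion.

(** * Standard monomials in the coordinate ring of M *)

Section RowPermutation.
Variables (R : comNzRingType) (k n : nat).
Local Notation m := (k + k)%N.

(** The matrix J~ pairs the row a with the row 2k - 1 - a; this renumbering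
    makes paired rows adjacent, as in [rowform]. *)
Definition paired_row (i : 'I_m) : nat :=
  match split i with inl a => a.*2 | inr b => (rev_ord b).*2.+1 end.

Lemma paired_row_lt i : (paired_row i < m)%N.
Proof.
rewrite /paired_row addnn; case: splitP => a _; first by rewrite ltn_double.
by rewrite ltn_Sdouble.
Qed.

Definition paired_ord i : 'I_m := Ordinal (paired_row_lt i).

Lemma paired_lshift a : paired_row (lshift k a) = a.*2.
Proof. by rewrite /paired_row -[lshift _ _]/(unsplit (inl _)) unsplitK. Qed.

Lemma paired_rshift b : paired_row (rshift k b) = (rev_ord b).*2.+1.
Proof. by rewrite /paired_row -[rshift _ _]/(unsplit (inr _)) unsplitK. Qed.

Lemma paired_ord_inj : injective paired_ord.
Proof.
move=> i j /(congr1 val) /=; rewrite -[i]splitK -[j]splitK.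
case: (split i) => a; case: (split j) => b /=;
  rewrite ?paired_lshift ?paired_rshift.
- by move=> /double_inj/val_inj->.
- by move/(congr1 odd); rewrite /= !odd_double.
- by move/(congr1 odd); rewrite /= !odd_double.
by move=> /succn_inj/double_inj/ord_inj/rev_ord_inj->.
Qed.

Definition paired_idx (t : 'I_(m * n)) : 'I_(m * n) :=
  let p := enum_val (cast_ord (esym (mxvec_cast m n)) t) in
  xidx (paired_ord p.1) p.2.

Lemma paired_idxE i j : paired_idx (mxvec_index i j) = xidx (paired_ord i) j.
Proof. by rewrite /paired_idx /mxvec_index cast_ordK enum_rankK. Qed.

Lemma paired_idx_inj : injective paired_idx.
Proof.
move=> t t'; case/mxvec_indexP: t => i j; case/mxvec_indexP: t' => i' j'.
rewrite !paired_idxE => E.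
have := @xmonE m n (paired_ord i) j (paired_ord i') j' (xidx (paired_ord i') j')
  (erefl _).
rewrite -{1}E mnmE eqxx => /esym/eqP; rewrite eqb1 => /andP[/eqP ii /eqP->].
by congr mxvec_index; apply: paired_ord_inj; apply: ord_inj.
Qed.

Definition pair_rows : coordM R k n -> {mpoly R[m * n]} :=
  msym (perm paired_idx_inj).

Lemma rowform_sum M' d c (x y : 'I_n) : rowform R M' d c x y = \sum_(a < d)
  (xvar R M' (c + a.*2) x * xvar R M' (c + a.*2.+1) y
   - xvar R M' (c + a.*2.+1) x * xvar R M' (c + a.*2) y).
Proof.
elim: d c => [|d IH] c; first by rewrite big_ord0.
rewrite big_ord_recl /= IH /= addn0 addn1; congr (_ + _).
by apply: eq_bigr => a _; rewrite /bump /= add1n doubleS !addnS !addSn.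
Qed.

Lemma pair_rows_gram i j : pair_rows (gram R k i j) = rowform R m k 0 i j.
Proof.
have varE a l : pair_rows (genericX R k n a l) = xvar R m (paired_row a) l.
  rewrite mxE /pair_rows /msym mmapX mmap1U permE paired_idxE.
  by rewrite -(xmon_U (paired_ord a)).
rewrite /gram Jtilde_form rowform_sum /pair_rows raddf_sum; apply: eq_bigr => a _.
rewrite raddfB /= !rmorphM /= -!/(pair_rows _) !varE.
by rewrite paired_lshift paired_rshift rev_ordK !add0n.
Qed.

Lemma pair_rows_dpow q l :
  pair_rows (dpow (gram R k (n := n)) q l) = dpow (rowform R m k 0) q l.
Proof.
rewrite /pair_rows (dpow_morph (msym (perm paired_idx_inj))).
by congr (dpow _ _ _); apply: funext => i; apply: funext => j; apply: pair_rows_gram.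
Qed.

Lemma dpow_gram_vanish q (l : seq 'I_n) : (k < q)%N -> dpow (gram R k (n := n)) q l = 0.
Proof.
move=> kq; apply: (@inj_msym _ _ (perm paired_idx_inj)).
rewrite -/(pair_rows _) pair_rows_dpow dpow_rowform_vanish // /pair_rows.
by apply: esym; apply: msym0.
Qed.

Lemma dpow_gram_lreg q (l : seq 'I_n) : (q <= k)%N -> size l = q.*2 -> incr l ->
  GRing.lreg (dpow (gram R k (n := n)) q l).
Proof.
move=> qk sl incl x y xy; apply: (@inj_msym _ _ (perm paired_idx_inj)).
have km : (0 + k.*2 <= m)%N by rewrite add0n -addnn.
have reg := leads_lreg (dpow_rowform_leads R km qk sl incl).
by apply: reg; rewrite -pair_rows_dpow /pair_rows -!msymM xy.
Qed.

Lemma tabprod_gram_free (s : seq (seq (seq 'I_n))) (c : seq (seq 'I_n) -> R) :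
    uniq s -> all (narrow_std k) s ->
    \sum_(T <- s) c T *: tabprod (gram R k (n := n)) T = 0 ->
  {in s, forall T, c T = 0}.
Proof.
have km : (k.*2 <= m)%N by rewrite -addnn.
move=> us ss E; apply: (std_free km us ss).
apply: etrans (msym0 _ (perm paired_idx_inj)).
rewrite -[in RHS]E raddf_sum; apply: eq_bigr => T _ /=.
rewrite msymZ; congr (_ *: _); rewrite /tabprod rmorph_prod; apply: eq_bigr => a _ /=.
by rewrite -[RHS]/(pair_rows _) pair_rows_dpow.
Qed.

End RowPermutation.

Section StandardSpan.
Variables (R : comNzRingType) (n : nat).
Local Notation P := (polyZ R n).
Local Notation Z := (zfun R (n := n)).
Implicit Types (T U : seq (seq 'I_n)) (p q : P).

Definition std_comb (s : seq (seq (seq 'I_n))) (c : seq (seq 'I_n) -> R) : P :=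
  \sum_(T <- s) c T *: tabprod Z T.

(** The coefficients are a function on tableaux so that repetitions cannot occur. *)
Definition in_std_span p := exists s c, [/\ uniq s, all (@std n) s & p = std_comb s c].

Lemma std_comb_sub s s' c : uniq s -> uniq s' -> {subset s <= s'} ->
  std_comb s c = std_comb s' (fun T => if T \in s then c T else 0).
Proof.
move=> us us' ss'; rewrite /std_comb.
rewrite [RHS](eq_bigr (fun T => if T \in s then c T *: tabprod Z T else 0)); last first.
  by move=> T _; case: ifP => // _; rewrite scale0r.
rewrite -big_mkcond -big_filter; apply: perm_big; apply: uniq_perm => //.
  exact: filter_uniq.
by move=> T; rewrite mem_filter; case: (boolP (T \in s)) => // /ss'->.
Qed.

Lemma in_std_span0 : in_std_span 0.
Proof. by exists [::], (fun=> 0); rewrite /std_comb big_nil. Qed.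

Lemma in_std_spanD p q : in_std_span p -> in_std_span q -> in_std_span (p + q).
Proof.
move=> [s [c [us ss ->]]] [s' [c' [us' ss' ->]]].
set s'' := undup (s ++ s'); have us'' : uniq s'' by apply: undup_uniq.
exists s'', (fun T => (if T \in s then c T else 0) + (if T \in s' then c' T else 0)).
split=> //.
  by apply/allP => T; rewrite mem_undup mem_cat => /orP[/(allP ss)|/(allP ss')].
rewrite (@std_comb_sub s s'') // => [|T]; last by rewrite mem_undup mem_cat => ->.
rewrite (@std_comb_sub s' s'') // => [|T]; last by rewrite mem_undup mem_cat orbC => ->.
by rewrite /std_comb -big_split; apply: eq_bigr => T _; rewrite scalerDl.
Qed.

Lemma in_std_spanZ a p : in_std_span p -> in_std_span (a *: p).
Proof.
move=> [s [c [us ss ->]]]; exists s, (fun T => a * c T); split=> //.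
by rewrite /std_comb scaler_sumr; apply: eq_bigr => T _; rewrite scalerA.
Qed.

Lemma in_std_span_tabprod T : even_rows T -> in_std_span (tabprod Z T).
Proof.
move=> eT; have := straightening (@zfun_alt R n) (@zfun_anti R n) eT.
elim=> [|_ [U [stdU _ ->]]|p q _ IHp _ IHq].
- exact: in_std_span0.
- by exists [:: U], (fun=> 1); rewrite /std_comb big_seq1 scale1r /= stdU.
by rewrite -[- q]scaleN1r; apply/in_std_spanD/in_std_spanZ.
Qed.

Lemma in_std_spanM p q : in_std_span p -> in_std_span q -> in_std_span (p * q).
Proof.
move=> [s [c [_ /allP ss ->]]] [s' [c' [_ /allP ss' ->]]].
rewrite /std_comb mulr_suml big_seq.
apply: (big_ind in_std_span) => [|p' q'|T Ts]; [exact: in_std_span0 | exact: in_std_spanD |].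
rewrite mulr_sumr big_seq.
apply: (big_ind in_std_span) => [|p' q'|U Us]; [exact: in_std_span0 | exact: in_std_spanD |].
rewrite -scalerAl -scalerAr -tabprod_cat; do 2!apply: in_std_spanZ.
apply: in_std_span_tabprod; rewrite /even_rows all_cat; apply/andP.
by split; apply: even_rows_std; [apply: ss | apply: ss'].
Qed.

Lemma standard_span p : in_std_span p.
Proof.
elim/mpoly_ring_ind: p => [c|t|p q|p q]; [| | exact: in_std_spanD | exact: in_std_spanM].
  by exists [:: [::]], (fun=> c); rewrite /std_comb big_seq1 /tabprod big_nil -mul_mpolyC mulr1.
have -> : 'X_t = tabprod Z [:: [:: (val (enum_val t)).1; (val (enum_val t)).2]].
  rewrite /tabprod big_seq1 /pf /dpow /= mulr1 subr0 /zfun mxE.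
  case: insubP => [p _ Ep|]; last by rewrite (valP (enum_val t)).
  rewrite (_ : p = enum_val t) ?enum_valK //; apply: val_inj; rewrite Ep.
  by rewrite -surjective_pairing.
exact: in_std_span_tabprod.
Qed.

End StandardSpan.

(** * The kernel and the image of the comorphism *)

Section PfaffianIdeal.
Variables (R : comNzRingType) (k n : nat).
Local Notation P := (polyZ R n).
Local Notation Z := (zfun R (n := n)).
Local Notation G := (gram R k (n := n)).
Local Notation Pf := (gen_ideal (@main_pfaffian R k.+1 n)).

Lemma incr_map_enum N (e : 'I_N -> 'I_n) :
  (forall i j : 'I_N, (i < j)%N -> (e i < e j)%N) -> incr (map e (enum 'I_N)).
Proof.
move=> He; rewrite /incr sorted_map; apply: (@sub_sorted _ (fun i j : 'I_N => (i < j)%N)) => //.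
by have := iota_ltn_sorted 0 N; rewrite -val_enum_ord sorted_map.
Qed.

Lemma main_pfaffianE (u : main_index k.+1 n) :
  main_pfaffian R u = dpow Z k.+1 (map (val u) (enum 'I_(k.+1.*2))).
Proof.
rewrite /main_pfaffian Pfaff_dpow -(dpow_map (val u) Z); congr (dpow _ _ _).
by apply: funext => i; apply: funext => j; rewrite mxE.
Qed.

Lemma piM_dpow q l : piM k (dpow Z q l) = dpow G q l.
Proof.
rewrite (dpow_morph (piM k (n := n))); congr (dpow _ _ _).
by apply: funext => i; apply: funext => j; apply: piM_zfun.
Qed.

Lemma piM_tabprod T : piM k (tabprod Z T) = tabprod G T.
Proof.
rewrite /tabprod; elim: T => [|a T IH]; first by rewrite !big_nil; apply: rmorph1.
rewrite !big_cons -IH -[pf G a]piM_dpow; exact: rmorphM.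
Qed.

Lemma piM_std_comb s c : piM k (std_comb s c) = \sum_(T <- s) c T *: tabprod G T.
Proof.
rewrite /std_comb; apply: etrans (rmorph_sum _ _ _ _) _; apply: eq_bigr => T _.
rewrite -mul_mpolyC -piM_tabprod -mul_mpolyC -(piM_C k n); exact: rmorphM.
Qed.

Lemma piM_main_pfaffian (u : main_index k.+1 n) : piM k (main_pfaffian R u) = 0.
Proof. by rewrite main_pfaffianE piM_dpow dpow_gram_vanish. Qed.

Lemma piM_ideal p : p \in Pf -> piM k p = 0.
Proof.
move=> /gen_idealP[c ->]; apply: etrans (rmorph_sum _ _ _ _) _.
apply: big1 => u _; apply: etrans (rmorphM _ _ _) _.
by rewrite /= piM_main_pfaffian mulr0.
Qed.

(** Larger Pfaffians expand into smaller ones, and a Pfaffian of size 2k + 2 is,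
    up to sign, the one of a main submatrix or has a repeated index. *)
Lemma dpow_ideal q l : (k < q)%N -> dpow Z q l \in Pf.
Proof.
elim: q l => // q IH l; rewrite ltnS leq_eqVlt => /orP[/eqP<-|kq]; last first.
  case: l => [|x l]; first exact: rpred0.
  rewrite dpow_cons; apply: (lwedge_closed (J := fun p => p \in Pf)).
  - exact: rpred0.
  - by move=> a b; apply: rpredB.
  by move=> y s _; apply/gen_idealMr/IH.
have [sl|/dpow_size->] := eqVneq (size l) (k.+1.*2); last exact: rpred0.
have [ul|ul] := boolP (uniq l); last first.
  by rewrite (alternating_dup (dpow_alternating (@zfun_alt R n) (@zfun_anti R n) _) ul) rpred0.
have [l' ll' incl'] := uniq_incr ul.
have [b ->] := alternating_perm (dpow_alternating (@zfun_alt R n) (@zfun_anti R n) k.+1) ll'.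
apply: gen_idealMr; have sl' : size l' = k.+1.*2 by rewrite -(perm_size ll').
have [x0 _] : exists x0, x0 \in l' by case: (l') sl' => // x s _; exists x; rewrite mem_head.
pose u := [ffun i : 'I_(k.+1.*2) => nth x0 l' i].
have uP : [forall a : 'I_(k.+1.*2), forall c : 'I_(k.+1.*2),
    (a < c)%N ==> (u a < u c)%N].
  apply/forallP=> a; apply/forallP=> c; apply/implyP=> ac; rewrite !ffunE.
  apply: (sorted_ltn_nth (leT := fun i j : 'I_n => (i < j)%N)) => //.
  - by move=> j i h; apply: ltn_trans.
  - by rewrite inE sl'.
  by rewrite inE sl'.
have -> : dpow Z k.+1 l' = main_pfaffian R (exist _ u uP : main_index k.+1 n).
  rewrite main_pfaffianE; congr (dpow _ _ _).
  apply: (@eq_from_nth _ x0) => [|i]; first by rewrite size_map size_enum_ord.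
  rewrite sl' => isl; rewrite (nth_map (Ordinal isl)) ?size_enum_ord //= ffunE.
  by rewrite nth_enum_ord.
apply/gen_idealP; exists (fun v => (v == (exist _ u uP : main_index k.+1 n))%:R).
rewrite (bigD1 (exist _ u uP : main_index k.+1 n)) //= eqxx mul1r big1 ?addr0 //.
by move=> v /negPf->; rewrite mul0r.
Qed.

Lemma tabprod_ideal T : std T -> ~~ all (fun a => size a <= k.*2)%N T -> tabprod Z T \in Pf.
Proof.
case/andP=> /allP pT _ /allPn[a aT]; rewrite -ltnNge => ka.
rewrite /tabprod (big_rem a) //= mulrC; apply: gen_idealMr; apply: dpow_ideal.
have /and3P[_ ea _] := pT a aT.
by rewrite -ltn_double even_halfK.
Qed.

(** A tableau with a row of size above 2k belongs to the ideal, so the other ones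
    span the quotient. *)
Lemma narrow_decomp p : exists s c r, [/\ uniq s, all (narrow_std k) s, r \in Pf &
  p = std_comb s c + r].
Proof.
have [s [c [us /allP ss ->]]] := standard_span p.
pose nar := (fun T : seq (seq 'I_n) => all (fun a => size a <= k.*2)%N T).
exists (filter nar s), c, (\sum_(T <- s | ~~ nar T) c T *: tabprod Z T); split.
- exact: filter_uniq.
- apply/allP=> T; rewrite mem_filter => /andP[nT /ss sT].
  by rewrite /narrow_std sT.
- rewrite big_seq_cond; apply: rpred_sum => T /andP[/ss sT nT].
  rewrite -mul_mpolyC; apply: gen_idealMr; exact: tabprod_ideal.
by rewrite /std_comb (bigID nar) /= big_filter.
Qed.

(** The narrow part of a decomposition of p is determined by the image of p, by
    linear independence in R[M]. *)
Lemma piM_kernel p : piM k p = 0 -> p \in Pf.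
Proof.
have [s [c [r [us ns rP ->]]]] := narrow_decomp p.
have -> : piM k (std_comb s c + r) = piM k (std_comb s c) + piM k r by apply: rmorphD.
rewrite (piM_ideal rP) addr0 piM_std_comb => /(tabprod_gram_free us ns) c0.
rewrite [std_comb s c]big1_seq ?add0r // => T Ts.
by rewrite c0 // scale0r.
Qed.

Lemma image_std q : exists s c, [/\ uniq s, all (narrow_std k) s &
  piM k q = \sum_(T <- s) c T *: tabprod G T].
Proof.
have [s [c [r [us ns rP ->]]]] := narrow_decomp q.
exists s, c; split=> //; rewrite -piM_std_comb.
have -> : piM k (std_comb s c + r) = piM k (std_comb s c) + piM k r by apply: rmorphD.
by rewrite (piM_ideal rP) addr0.
Qed.

End PfaffianIdeal.

(** * Descent along two minimal rows *)

Section MinimalRows.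
Variables (k n : nat).
Hypothesis kn : (k.+1.*2 <= n)%N.
Implicit Types (a b : seq 'I_n) (T U : seq (seq 'I_n)).
Local Notation m := (k + k)%N.

Fact first_idx_lt (i : 'I_m) : (i < n)%N.
Proof. by have := ltn_ord i; lia. Qed.

Fact second_idx_lt (i : 'I_m) : (i + (i.+1 == m) < n)%N.
Proof. by have := ltn_ord i; case: eqP; lia. Qed.

Definition first_idx (i : 'I_m) : 'I_n := Ordinal (first_idx_lt i).
Definition second_idx (i : 'I_m) : 'I_n := Ordinal (second_idx_lt i).
Definition first_row := map first_idx (enum 'I_m).
(** The row (0, ..., 2k - 2, 2k): only the last index is raised by one. *)
Definition second_row := map second_idx (enum 'I_m).

Lemma first_row_incr : incr first_row.
Proof. exact: incr_map_enum. Qed.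

Lemma second_row_incr : incr second_row.
Proof.
apply: incr_map_enum => i j ij /=.
by have := ltn_ord j; case: eqP; case: eqP; lia.
Qed.

Lemma size_first_row : size first_row = k.*2.
Proof. by rewrite size_map size_enum_ord addnn. Qed.

Lemma size_second_row : size second_row = k.*2.
Proof. by rewrite size_map size_enum_ord addnn. Qed.

Lemma onth_map_enum (e : 'I_m -> 'I_n) (i : 'I_m) :
  onth (map e (enum 'I_m)) i = Some (e i).
Proof.
rewrite onthE -map_comp (nth_map i) ?size_enum_ord //=.
by rewrite nth_ord_enum.
Qed.

Lemma incr_gap a q q' x x' : incr a -> onth a q = Some x -> onth a q' = Some x' ->
  (q <= q')%N -> (x + (q' - q) <= x')%N.
Proof.
elim: a q q' x => [|y a IH] [|q] [|q'] x //= inca Ex Ex' qq.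
- by case: Ex Ex' => -> [->]; rewrite addn0.
- case: Ex => <-{x}; case: a IH inca Ex' => [|w a] IH inca Ex'; first by rewrite onth0n in Ex'.
  move: inca; rewrite /incr /= => /andP[yw inca].
  by have := IH 0%N q' w inca (erefl _) Ex' (leq0n _); lia.
by have := IH q q' x (path_sorted inca) Ex Ex' qq; rewrite subSS.
Qed.

Lemma row_le_first b : incr b -> (size b <= k.*2)%N -> row_le first_row b.
Proof.
move=> incb sb; apply/row_leP => q y qy.
have qm : (q < m)%N by rewrite addnn (leq_trans _ sb) // -onthTE qy.
exists (first_idx (Ordinal qm)); first exact: (onth_map_enum _ (Ordinal qm)).
have [x0 E0] : exists x0, onth b 0 = Some x0 by case: (b) qy => [|x s]; [rewrite onth0n | exists x].
by have := incr_gap incb E0 qy (leq0n _); rewrite /=; lia.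
Qed.

(** A strictly increasing row b has b_q >= q; if it has an entry in column 2k - 1 and
    this entry is 2k - 1, then b_q = q throughout. *)
Lemma row_le_second b : incr b -> (size b <= k.*2)%N -> b != first_row ->
  row_le second_row b.
Proof.
move=> incb sb nb; apply/row_leP => q y qy.
have qm : (q < m)%N by rewrite addnn (leq_trans _ sb) // -onthTE qy.
exists (second_idx (Ordinal qm)); first exact: (onth_map_enum _ (Ordinal qm)).
have [x0 E0] : exists x0, onth b 0 = Some x0 by case: (b) qy => [|x s]; [rewrite onth0n | exists x].
have := incr_gap incb E0 qy (leq0n _); rewrite /=; case: eqP => [Eq|_]; last by lia.
move=> gap; rewrite leqNgt; apply: contra nb => yq.
have sbE : size b = m.
  by apply/eqP; rewrite eqn_leq {1}addnn sb -Eq /= -onthTE qy.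
apply/eqP/eq_from_onth => p; have [pm|mp] := ltnP p m; last first.
  by rewrite !onth_default ?sbE // size_first_row -addnn.
rewrite (onth_map_enum _ (Ordinal pm)).
have [x px] : exists x, onth b p = Some x.
  by have := onthTE b p; rewrite sbE pm; case: onth => // x _; exists x.
rewrite px; congr Some; apply: val_inj => /=.
have pq : (p <= q)%N by rewrite -ltnS Eq.
have := incr_gap incb E0 px (leq0n _); have := incr_gap incb px qy pq.
by move: yq gap Eq => /=; lia.
Qed.

Hypothesis k_gt0 : (0 < k)%N.

Lemma pfrow_first : pfrow first_row.
Proof.
by rewrite /pfrow first_row_incr -size_eq0 size_first_row odd_double -lt0n double_gt0.
Qed.

Lemma pfrow_second : pfrow second_row.
Proof.
by rewrite /pfrow second_row_incr -size_eq0 size_second_row odd_double -lt0n double_gt0.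
Qed.

Lemma narrow_std_cons a T : pfrow a -> (size a <= k.*2)%N -> narrow_std k T ->
  (forall b, ohead T = Some b -> row_le a b) -> narrow_std k (a :: T).
Proof.
move=> pa sa /andP[/andP[pT sT] nT] Ha; rewrite /narrow_std /std /= pa pT sa nT !andbT.
by case: T sT Ha {pT nT} => //= b T -> /(_ b (erefl _))->.
Qed.

Lemma narrow_head b T : narrow_std k (b :: T) -> incr b /\ (size b <= k.*2)%N.
Proof. by case/andP=> /andP[/= /andP[/and3P[-> _ _] _] _] /andP[->]. Qed.

Lemma narrow_std_first T : narrow_std k T -> narrow_std k (first_row :: T).
Proof.
move=> nT; apply: narrow_std_cons => //; first exact: pfrow_first.
  by rewrite size_first_row.
case: T nT => // b T /narrow_head[incb sb] _ [<-]; exact: row_le_first.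
Qed.

Lemma second_neq_first : second_row != first_row.
Proof.
apply/eqP => E; have m0 : (m.-1 < m)%N by rewrite prednK // addn_gt0 k_gt0.
have := onth_map_enum second_idx (Ordinal m0).
rewrite -/second_row E onth_map_enum => -[] /=.
by rewrite prednK ?eqxx ?addn1 //; lia.
Qed.

Lemma narrow_std_second N T : narrow_std k T -> ohead T != Some first_row ->
  narrow_std k (nseq N second_row ++ T).
Proof.
move=> nT hT; elim: N => // N IH; apply: narrow_std_cons => //.
- exact: pfrow_second.
- by rewrite size_second_row.
case: N IH => [|N] IH b /= hb; last first.
  case: hb => <-; apply: row_le_second; rewrite ?size_second_row //.
    exact: second_row_incr.
  exact: second_neq_first.
case: T nT hT hb {IH} => // c T /narrow_head[incc sc] hc [<-].
exact: row_le_second.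
Qed.

End MinimalRows.

Section Descent.
Variables (R : comNzRingType) (k n : nat).
Hypotheses (k_gt0 : (0 < k)%N) (kn : (k.+1.*2 <= n)%N).
Local Notation P := (polyZ R n).
Local Notation M := (coordM R k n).
Local Notation G := (gram R k (n := n)).
Local Notation a1 := (first_row kn).
Local Notation a2 := (second_row kn).
Local Notation d1 := (dpow G k a1).
Local Notation d2 := (dpow G k a2).

Definition in_image (f : M) := exists q : P, piM k q = f.

Lemma in_image_comb (s : seq (seq (seq 'I_n))) (c : seq (seq 'I_n) -> R) g :
  in_image (\sum_(T <- s) c T *: tabprod G (g T)).
Proof.
exists (\sum_(T <- s) c T *: tabprod (zfun R (n := n)) (g T)).
apply: etrans (rmorph_sum _ _ _ _) _; apply: eq_bigr => T _.
rewrite -mul_mpolyC -piM_tabprod -mul_mpolyC -(piM_C k n); exact: rmorphM.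
Qed.

Lemma d1_reg : GRing.lreg d1.
Proof. exact: dpow_gram_lreg (leqnn k) (size_first_row kn) (first_row_incr kn). Qed.

Lemma tabprod_first T : tabprod G (a1 :: T) = d1 * tabprod G T.
Proof. by rewrite tabprod_cons /pf size_first_row doubleK. Qed.

Lemma tabprod_second N T : tabprod G (nseq N a2 ++ T) = d2 ^+ N * tabprod G T.
Proof.
elim: N => [|N IH]; first by rewrite mul1r.
by rewrite /= tabprod_cons IH /pf size_second_row doubleK mulrA -exprS.
Qed.

(** Write d1 f in the standard basis and subtract the multiples of d1, so that
    no tableau starts with a1. Multiplying by d2^N prefixes these
    tableaux by a2, which keeps them standard and not starting with a1; but the
    result is d1 times an element of S, whose standard expansion consists of
    tableaux starting with a1. By linear independence nothing is left. *)
Lemma descent f N : in_image (d1 * f) -> in_image (d2 ^+ N * f) -> in_image f.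
Proof.
move=> [q Eq] [q' Eq'].
have [s [c [us ns Es]]] := image_std k q.
pose hd T := ohead T == Some a1.
pose f1 := \sum_(T <- filter hd s) c T *: tabprod G (behead T).
have hdE T : hd T -> a1 :: behead T = T by case: T => //= a T /eqP[->].
have Ef1 : d1 * f1 = \sum_(T <- filter hd s) c T *: tabprod G T.
  rewrite mulr_sumr big_seq [RHS]big_seq; apply: eq_bigr => T.
  by rewrite mem_filter => /andP[hT _]; rewrite -scalerAr -tabprod_first hdE.
pose g := f - f1; pose s2 := filter (predC hd) s.
have Eg : d1 * g = \sum_(T <- s2) c T *: tabprod G T.
  rewrite mulrBr Ef1 -Eq Es big_filter (bigID hd) /=.
  rewrite addrAC subrr add0r.
  by rewrite /s2 big_filter.
have [q1 Eq1] := in_image_comb (filter hd s) c behead.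
have [u [d [uu nu Eu]]] : exists u d, [/\ uniq u, all (narrow_std k) u &
    d2 ^+ N * g = \sum_(T <- u) d T *: tabprod G T].
  have [q2 Eq2] := in_image_comb (filter hd s) c (fun T => nseq N a2 ++ behead T).
  have [u [d [uu nu Eu]]] := image_std k (q' - q2).
  exists u, d; split=> //; rewrite -Eu.
  have -> : piM k (q' - q2) = piM k q' - piM k q2 by apply: rmorphB.
  rewrite Eq' Eq2 mulrBr; congr (_ - _); rewrite mulr_sumr; apply: eq_bigr => T _.
  by rewrite -scalerAr tabprod_second.
(* the tableaux of d2^N d1 g - d1 (d2^N g) = 0, with their coefficients *)
pose w := map (cat (nseq N a2)) s2 ++ map (cons a1) u.
pose e W := if hd W then - d (behead W) else c (drop N W).
have hd2 T : T \in s2 -> ~~ hd (nseq N a2 ++ T).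
  rewrite mem_filter => /andP[hT _]; case: N {Eq' Eu w e} => // N /=.
  by rewrite /hd /=; apply/eqP => -[]; apply/eqP/(second_neq_first kn k_gt0).
have uw : uniq w.
  rewrite cat_uniq !map_inj_in_uniq ?filter_uniq // => [|x y _ _ []//|x y _ _ E].
    rewrite uu andbT; apply/hasPn => W /mapP[U Uu ->].
    by apply/mapP => -[T /hd2 hT E]; move: hT; rewrite -E /hd /= eqxx.
  by have := congr1 (drop N) E; rewrite !drop_size_cat ?size_nseq.
have nw : all (narrow_std k) w.
  rewrite all_cat !all_map; apply/andP; split; apply/allP => T.
    rewrite mem_filter => /andP[hT /(allP ns) nT]; exact: narrow_std_second.
  by move/(allP nu) => nT; apply: narrow_std_first.
have E0 : \sum_(W <- w) e W *: tabprod G W = 0.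
  rewrite big_cat !big_map /=.
  have -> : \sum_(T <- s2) e (nseq N a2 ++ T) *: tabprod G (nseq N a2 ++ T) =
      d2 ^+ N * (d1 * g).
    rewrite Eg mulr_sumr big_seq [RHS]big_seq; apply: eq_bigr => T Ts.
    by rewrite /e (negPf (hd2 T Ts)) drop_size_cat ?size_nseq // tabprod_second scalerAr.
  have -> : \sum_(U <- u) e (a1 :: U) *: tabprod G (a1 :: U) = - (d1 * (d2 ^+ N * g)).
    rewrite Eu mulr_sumr -sumrN; apply: eq_bigr => U _.
    by rewrite /e /hd /= eqxx tabprod_first scaleNr scalerAr.
  by rewrite mulrCA subrr.
have c0 T : T \in s2 -> c T = 0.
  move=> Ts; have Tw : nseq N a2 ++ T \in w by rewrite mem_cat map_f.
  have := tabprod_gram_free uw nw E0 Tw.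
  by rewrite /e (negPf (hd2 T Ts)) drop_size_cat ?size_nseq.
exists q1; rewrite Eq1 -/f1; apply: d1_reg; apply/esym/eqP.
rewrite -subr_eq0 -mulrBr -/g Eg big1_seq // => T /andP[_ /c0->].
by rewrite scale0r.
Qed.

Lemma invariant_in_image f : f \in @is_invariant R k n -> in_image f.
Proof.
move=> fI.
have den (e : 'I_(k + k) -> 'I_n) : incr (map e (enum 'I_(k + k))) ->
    exists N, in_image (dpow G k (map e (enum 'I_(k + k))) ^+ N * f).
  move=> ince.
  have ue : uniq (map e (enum 'I_(k + k))).
    by apply: sorted_uniq ince => [j i h|i]; [apply: ltn_trans | apply: ltnn].
  have se : size (map e (enum 'I_(k + k))) = k.*2 by rewrite size_map size_enum_ord addnn.
  have [N [q Eq]] := invariant_denominator ue fI (dpow_gram_lreg (leqnn k) se ince).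
  by exists N, q; rewrite -Eq piM_dpow.
have [N1 H1] := den _ (first_row_incr kn); have [N2 H2] := den _ (second_row_incr kn).
elim: N1 H1 => [|N1 IH] H1; first by rewrite mul1r in H1.
apply: IH; apply: (descent (N := N2)); first by rewrite mulrA -exprS.
have [q Eq] := H2; exists (dpow (zfun R (n := n)) k a1 ^+ N1 * q).
rewrite mulrCA -Eq -piM_dpow; apply: etrans (rmorphM _ _ _) _; congr (_ * _).
exact: rmorphXn.
Qed.

End Descent.

Section ComparisonMap.
Variables (R : comNzRingType) (k n : nat).
Local Notation Y := (coordY R k.+1 n).
Local Notation cls := (quot_class (@main_pfaffian R k.+1 n)).

(** Defined on representatives; it depends only on the class because the ideal is killed. *)
Definition comparison (y : Y) : invariants R k n :=
  Invariant (piM_invariant k (repr y)).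

Lemma coordY_repr (y : Y) : exists p, y = cls p.
Proof. by exists (repr y); rewrite /quot_class reprK. Qed.

Lemma comparisonE p : invariant_val (comparison (cls p)) = piM k p.
Proof.
have : repr (cls p) - p \in gen_ideal (@main_pfaffian R k.+1 n).
  by rewrite -quot_class_eq /quot_class reprK.
move/piM_ideal => E; apply/eqP; rewrite -subr_eq0 /=; apply/eqP.
by rewrite -E; apply: esym; apply: rmorphB.
Qed.

Fact comparison_zmod_morphism : zmod_morphism comparison.
Proof.
move=> x y; have [p ->] := coordY_repr x; have [q ->] := coordY_repr y.
have valB (a b : invariants R k n) :
    invariant_val (a - b) = invariant_val a - invariant_val b by exact: (rmorphB \val).
rewrite -rmorphB; apply: val_inj; apply: etrans (comparisonE _) _.
apply: etrans (rmorphB _ _ _) _; apply: esym; apply: etrans (valB _ _) _.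
by rewrite !comparisonE.
Qed.

Fact comparison_monoid_morphism : monoid_morphism comparison.
Proof.
have valM (a b : invariants R k n) :
    invariant_val (a * b) = invariant_val a * invariant_val b by exact: (rmorphM \val).
split=> [|x y].
  apply: val_inj; rewrite -(rmorph1 cls); apply: etrans (comparisonE _) _.
  by apply: etrans (rmorph1 _) _; apply: esym; exact: (rmorph1 \val).
have [p ->] := coordY_repr x; have [q ->] := coordY_repr y.
rewrite -rmorphM; apply: val_inj; apply: etrans (comparisonE _) _.
apply: etrans (rmorphM _ _ _) _; apply: esym; apply: etrans (valM _ _) _.
by rewrite !comparisonE.
Qed.

HB.instance Definition _ := GRing.isZmodMorphism.Build Y (invariants R k n)
  comparison comparison_zmod_morphism.
HB.instance Definition _ := GRing.isMonoidMorphism.Build Y (invariants R k n)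
  comparison comparison_monoid_morphism.

Lemma comparison_inj : injective comparison.
Proof.
move=> x y; have [p ->] := coordY_repr x; have [q ->] := coordY_repr y.
move/(congr1 (@invariant_val R k n)); rewrite !comparisonE => pq.
apply/eqP; rewrite quot_class_eq; apply: piM_kernel.
by apply: etrans (rmorphB _ _ _) _; rewrite /= pq subrr.
Qed.

Lemma comparison_bij : (0 < k)%N -> (k.+1.*2 <= n)%N -> bijective comparison.
Proof.
move=> k_gt0 kn.
have surj (f : invariants R k n) : exists y, comparison y = f.
  have [q Eq] := invariant_in_image k_gt0 kn (valP f).
  by exists (cls q); apply: val_inj; apply: etrans (comparisonE _) _.
have [h hK] := choice surj.
by exists h => // y; apply: comparison_inj.
Qed.

End ComparisonMap.

Theorem theorem17 (R : comNzRingType) (t n : nat)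
    (ht : (4 <= 2 * t)%N) (hn : (2 * t <= n)%N) :
  exists phi : {rmorphism coordY R t n -> invariants R t.-1 n},
    (forall p : polyZ R n,
       invariant_val (phi (quot_class (@main_pfaffian R t n) p)) = pi_comorphism t.-1 p)
    /\ bijective phi.
Proof.
case: t ht hn => [|k] // ht hn.
exists (@comparison R k n : {rmorphism coordY R k.+1 n -> invariants R k n}).
split=> [p|]; first exact: comparisonE.
by apply: comparison_bij; lia.
Qed.
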